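(* For every $x \in X$ the state $\Psi_x$ is a $*$-homomorphism from $\mathcal A_\infty$ to $\mathbb C$, so that $\widehat\Psi \colon \mathcal A_\infty \to C_b^\infty(X)$, $(\widehat\Psi a)(x) = \Psi_x(a)$, is a $*$-algebra homomorphism. Furthermore, $\widehat\Psi \colon \mathcal A \to C_b(X)$, $(\widehat\Psi a)(x) = \Psi_x(a)$, is a $C^*$-algebra homomorphism, and the state space embedding $\Psi \colon X \to S(\mathcal A)$, $\Psi(x) = \Psi_x$, is continuous in the weak$^*$ topology.
   Context: Setting. $X$ is a $C^\infty$ manifold and $\Phi^t \colon X \to X$, $t \in \mathbb R$, is a flow generated by a $C^\infty$ vector field $\vec V$, with derivation $Vf = \vec V \cdot \nabla f$ on $C^\infty(X)$. $\mathcal H \subset C^\infty(X)$ is a complex reproducing kernel Hilbert space (RKHS) with strictly positive-definite kernel $k$ and kernel sections $k_x = k(x,\cdot)$, so $f(x) = \langle k_x, f\rangle_{\mathcal H}$ (inner products conjugate-linear in the first argument). As an unbounded operator on $\mathcal H$, $V$ has domain $\{f \in \mathcal H : Vf \in \mathcal H\}$; $V^*$ is its adjoint. Standing assumption 1. (a) $V \colon \mathcal H \to C(X)$ is continuous for the compact-open topology on $C(X)$. (b) $\mathcal H_\infty \subseteq \mathrm{dom}(V) \cap \mathrm{dom}(V^* )$ is a dense subspace of $\mathcal H$ invariant under $V$ and $V^*$. (c) With $V_1 = V$, $V_2 = V^*$, for every $f \in \mathcal H_\infty$ the series $\sum_{n=0}^\infty \frac{z^n}{n!} \sum_{\epsilon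 \colon [n] \to [2]} \lVert V_{\epsilon(1)} \cdots V_{\epsilon(n)} f \rVert_{\mathcal H}$ has a strictly positive radius of convergence, where $[n]=\{1,\dots,n\}$. Standing assumption 2. $\mathcal H$ is a reproducing kernel Hilbert algebra: $k_x \mapsto k_x \otimes k_x$ extends to a bounded linear map $\mathcal H \to \mathcal H \otimes \mathcal H$. $\mathcal S \subset \mathcal H_\infty$ is a finite-dimensional subspace such that the subalgebra generated by $\mathcal S$ is dense in $\mathcal H$. Standing assumption 3. $\lVert k_x\rVert_{\mathcal H} = 1$ for all $x \in X$. Fock space. $\mathfrak H = \ell^2(\mathbb N) \otimes \mathcal H$, $\mathfrak H_0 = C_c(\mathbb N) \otimes_{\mathrm{alg}} \mathcal H_\infty$, and $e_1$ is the first canonical basis vector of $\ell^2(\mathbb N)$. $\mathfrak H^{\vee n}$ is the closed subspace of symmetric tensors in $\mathfrak H^{\otimes n}$ ($\mathfrak H^{\vee 0} = \mathbb C$); $u_1 \vee \cdots \vee u_n = \frac1{n!}\sum_{\sigma \in S_n} u_{\sigma(1)} \otimes \cdots \otimes u_{\sigma(n)}$. $\mathfrak F$ is the Hilbert space completion of $\bigoplus_{n\ge0} (\mathfrak H^{\vee n}, w(n)^2 \langle\cdot,\cdot\rangle_{\mathfrak H^{\vee n}})$, with weights $w(n) = e^{\tau n^p}$, $\tau>0$, $p \in (0,1)$; the symmetric tensor product $\vee$ extends to a bounded bilinear commutative unital multiplication on $\mathfrak F$. Operators and states. For $u \in \mathfrak H$, $a_u^* \in B(\mathfrak F)$ is $a_u^*\eta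 = u \vee \eta$ and $a_u$ is its adjoint. $\mathcal A_\infty \subset B(\mathfrak F)$ is the $*$-algebra generated by $\mathrm{Id}_{\mathfrak F}$ and $\{a_u : u \in \mathfrak H_0\}$; $\mathcal A$ is the $C^*$-algebra it generates in $B(\mathfrak F)$, and $S(\mathcal A)$ is the state space of $\mathcal A$. For $x \in X$, $m \in \mathbb N$, $\mathcal K_x^{(m)} = \sum_{n=m}^\infty w(n)^{-2} (e_1 \otimes k_x)^{\vee n} \in \mathfrak F$, $\varphi_x^m(a) = \langle \mathcal K_x^{(m)}, a \mathcal K_x^{(m)}\rangle_{\mathfrak F}/\lVert \mathcal K_x^{(m)}\rVert_{\mathfrak F}^2$, and $\Psi_x(a) = \lim_{m\to\infty} \varphi_x^m(a)$ for $a \in \mathcal A$; this limit exists and defines $\Psi_x \in S(\mathcal A)$. $C_b(X)$ is the algebra of bounded continuous complex functions on $X$, with complex conjugation as involution, and $C_b^\infty(X)$ its subalgebra of bounded smooth functions. *)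

(* Defs.v *)
From HB Require Import structures.
From mathcomp Require Import all_boot all_order all_fingroup all_algebra.
From mathcomp Require Import complex.
From mathcomp Require Import all_classical all_reals all_analysis.

Set Implicit Arguments.
Unset Strict Implicit.
Unset Printing Implicit Defensive.

Import Order.TTheory GRing.Theory Num.Theory.
Import numFieldNormedType.Exports.

Local Open Scope complex_scope.
Local Open Scope classical_set_scope.
Local Open Scope ring_scope.

Section SmoothOn.
Context {R : realType} {d : nat}.

(* Existence and continuity of all iterated partial derivatives of order at
   most k; meant for U open, so that 'D_v only sees values of f on U. *)
Fixpoint Ck (k : nat) (U : set 'rV[R]_d) (f : 'rV[R]_d -> R) : Prop :=
  (forall y, U y -> {for y, continuous f}) /\
  (if k is k'.+1 then
     forall j : 'I_d,
       (forall y, U y -> derivable f y (delta_mx 0 j)) /\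
       Ck k' U (fun y => 'D_(delta_mx 0 j) f y)
   else True).

Definition smooth_on (U : set 'rV[R]_d) (f : 'rV[R]_d -> R) : Prop :=
  forall k, Ck k U f.

End SmoothOn.

Record manifold (R : realType) (d : nat) := Manifold {
  mpoint :> topologicalType;
  manifold_hausdorff : hausdorff_space mpoint;
  manifold_second_countable : @second_countable mpoint;
  chart_index : Type;
  chart_dom : chart_index -> set mpoint;
  chart : chart_index -> mpoint -> 'rV[R]_d;
  chart_inv : chart_index -> 'rV[R]_d -> mpoint;
  chart_at : mpoint -> chart_index;
  chart_at_dom : forall x, chart_dom (chart_at x) x;
  chart_dom_open : forall i, open (chart_dom i);
  chart_cod_open : forall i, open (chart i @` chart_dom i);
  chartK : forall i x, chart_dom i x -> chart_inv i (chart i x) = x;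
  chart_continuous : forall i x, chart_dom i x ->
    {for x, continuous (chart i)};
  chart_inv_continuous : forall i y, (chart i @` chart_dom i) y ->
    {for y, continuous (chart_inv i)};
  chart_transition : forall i j (k : 'I_d),
    smooth_on (chart i @` (chart_dom i `&` chart_dom j))
      (fun y => chart j (chart_inv i y) ord0 k)
}.

Section Manifold.
Context {R : realType} {d : nat} (X : manifold R d).

Definition smoothR (f : X -> R) : Prop :=
  forall i : chart_index X,
    smooth_on (chart i @` chart_dom i) (f \o chart_inv i).

Definition smoothC (f : X -> R[i]) : Prop :=
  smoothR (fun x => complex.Re (f x)) /\ smoothR (fun x => complex.Im (f x)).

(* [vf i x] is the coordinate vector of the tangent vector at x in chart i. *)
Record vector_field := VectorField {
  vf : chart_index X -> X -> 'rV[R]_d;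
  vf_smooth : forall i (k : 'I_d),
    smooth_on (chart i @` chart_dom i) (fun y => vf i (chart_inv i y) ord0 k);
  vf_transition : forall i j x, chart_dom i x -> chart_dom j x ->
    vf j x = 'D_(vf i x) (chart j \o chart_inv i) (chart i x)
}.

Variable V : vector_field.

Definition vf_derR (f : X -> R) (x : X) : R :=
  'D_(vf V (chart_at x) x) (f \o chart_inv (chart_at x))
    (chart (chart_at x) x).

Definition vf_der (f : X -> R[i]) (x : X) : R[i] :=
  vf_derR (fun y => complex.Re (f y)) x +i* vf_derR (fun y => complex.Im (f y)) x.

(* The continuity clause makes the differential equation meaningful, the chart
   maps being arbitrary outside their domains; joint smoothness of the flow is
   then automatic. *)
Record generates_flow (Phi : R -> X -> X) : Prop := {
  flow0 : forall x, Phi 0 x = x;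
  flowD : forall s t x, Phi (s + t) x = Phi s (Phi t x);
  flow_continuous : forall x, continuous (fun t : R => Phi t x);
  flow_derive : forall i x (t : R), chart_dom i (Phi t x) ->
    is_derive t 1 (fun s : R => chart i (Phi s x)) (vf V i (Phi t x))
}.

End Manifold.

(* The inner product is conjugate-linear in the first argument. *)
HB.mixin Record isHilbert (R : realType) H of CompleteNormedModule R[i] H := {
  inner : H -> H -> R[i];
  innerDr : forall u v w : H, inner u (v + w) = inner u v + inner u w;
  innerZr : forall (c : R[i]) (u v : H), inner u (c *: v) = c * inner u v;
  innerC : forall u v : H, inner v u = (inner u v)^*;
  inner_norm : forall u : H, inner u u = `|u| ^+ 2
}.

#[short(type="hilbertType")]
HB.structure Definition Hilbert (R : realType) :=
  {H of CompleteNormedModule R[i] H & isHilbert R H}.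

Section LinearAlgebra.
Context {R : realType}.

Definition is_subspace (E : lmodType R[i]) (A : set E) : Prop :=
  A 0 /\ forall (c : R[i]) (u v : E), A u -> A v -> A (c *: u + v).

Definition lin_span (E : lmodType R[i]) (A : set E) : set E :=
  smallest (@is_subspace E) A.

Definition finite_dim (E : lmodType R[i]) (A : set E) : Prop :=
  exists s : seq E, A = lin_span [set` s].

Definition bounded_linear (E F : normedModType R[i]) (T : E -> F) : Prop :=
  linear T /\ exists M : R, forall u, `|T u| <= M%:C * `|u|.

(* Adjoint of an operator T with dense domain D. *)
Definition adjoint_dom (H : hilbertType R) (D : set H) (T : H -> H) : set H :=
  [set u | exists u' : H, forall v, D v -> inner u (T v) = inner u' v].

Definition adjoint_on (H : hilbertType R) (D : set H) (T : H -> H) (u : H) : H :=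
  xget 0 [set u' : H | forall v, D v -> inner u (T v) = inner u' v].

Definition adjoint (H : hilbertType R) (T : H -> H) : H -> H :=
  adjoint_on setT T.

End LinearAlgebra.

(* The space l^2(N): Hilbert space with carrier identified, through [coord],
   with the set of square-summable sequences. *)
Record ell2 (R : realType) := Ell2 {
  ell2_space :> hilbertType R;
  coord : ell2_space -> nat -> R[i];
  coord_linear : forall (c : R[i]) u v n,
    coord (c *: u + v) n = c * coord u n + coord v n;
  coord_inj : injective coord;
  coord_range : forall s : nat -> R[i],
    (exists u, coord u = s) <->
    cvgn (series (fun n => `|s n| ^+ 2) : nat -> R[i]^o);
  coord_inner : forall u v,
    (series (fun n => (coord u n)^* * coord v n) : nat -> R[i]^o) @ \oo
      --> (inner u v : R[i]^o)
}.

Section Ell2.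
Context {R : realType} (L : ell2 R).

(* First canonical basis vector, sequences being indexed from 0. *)
Definition ell2_e1 : L :=
  xget 0 [set u : L | coord u = fun n => (n == 0)%:R].

Definition finsupp_seq : set L :=
  [set u | exists N, forall n, (N <= n)%N -> coord u n = 0].

End Ell2.

(* Hilbert tensor products are given up to unitary isomorphism, as completions
   of the algebraic tensor products for the product inner product. *)
Record tensor_product (R : realType) (H K : hilbertType R) := TensorProduct {
  tensor_space :> hilbertType R;
  tensor : H -> K -> tensor_space;
  tensor_linearl : forall v, linear (fun u => tensor u v);
  tensor_linearr : forall u, linear (tensor u);
  tensor_inner : forall u u' v v',
    inner (tensor u v) (tensor u' v') = inner u u' * inner v v';
  tensor_dense :
    dense (lin_span [set t | exists u v, t = tensor u v])
}.

Record tensor_power (R : realType) (H : hilbertType R) (n : nat) :=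
    TensorPower {
  power_space :> hilbertType R;
  tensorn : ('I_n -> H) -> power_space;
  tensorn_linear : forall (i : 'I_n) (u : 'I_n -> H),
    linear (fun v : H => tensorn (fun j => if j == i then v else u j));
  tensorn_inner : forall u v,
    inner (tensorn u) (tensorn v) = \prod_i inner (u i) (v i);
  tensorn_dense : dense (lin_span (range tensorn))
}.

Section SymmetricPower.
Context {R : realType} {H : hilbertType R} {n : nat} (T : tensor_power H n).

Definition vee (u : 'I_n -> H) : T :=
  (n`!%:R)^-1 *: \sum_(s : 'S_n) tensorn T (fun i => u (s i)).

Definition sym_power : set T := closure (lin_span (range vee)).

End SymmetricPower.

Arguments sym_power {R H n} T _.

Definition fcat {T : Type} {m n : nat} (u : 'I_m -> T) (v : 'I_n -> T)
    (i : 'I_(m + n)) : T :=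
  match fintype.split i with inl j => u j | inr k => v k end.

(* Weighted symmetric Fock space over H: completion of the direct sum of the
   symmetric powers, the n-th one (embedded by [fock_in n]) carrying
   w(n)^2 times its inner product, together with the bounded bilinear
   extension [fock_mul] of the symmetric tensor product.  [fock_in n] is
   only relevant on [sym_power]. *)
Record fock_space (R : realType) (H : hilbertType R) (w : nat -> R) :=
    FockSpace {
  fock_carrier :> hilbertType R;
  fock_power : forall n, tensor_power H n;
  fock_in : forall n, fock_power n -> fock_carrier;
  fock_in_linear : forall n (c : R[i]) (s t : fock_power n),
    sym_power _ s -> sym_power _ t ->
    fock_in (c *: s + t) = c *: fock_in s + fock_in t;
  fock_in_inner : forall n (s t : fock_power n),
    sym_power _ s -> sym_power _ t ->
    inner (fock_in s) (fock_in t) = (w n ^+ 2)%:C * inner s t;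
  fock_in_orthogonal : forall m n (s : fock_power m) (t : fock_power n),
    m <> n -> sym_power _ s -> sym_power _ t ->
    inner (fock_in s) (fock_in t) = 0;
  fock_in_dense :
    dense (lin_span (\bigcup_n (@fock_in n @` sym_power (fock_power n))));
  fock_mul : fock_carrier -> fock_carrier -> fock_carrier;
  fock_mul_linearl : forall b, linear (fun a => fock_mul a b);
  fock_mul_linearr : forall a, linear (fock_mul a);
  fock_mul_bounded : exists M : R, forall a b,
    `|fock_mul a b| <= M%:C * `|a| * `|b|;
  fock_mul_vee : forall m n (u : 'I_m -> H) (v : 'I_n -> H),
    fock_mul (fock_in (vee (fock_power m) u)) (fock_in (vee (fock_power n) v)) =
    fock_in (vee (fock_power (m + n)) (fcat u v))
}.

Section OperatorAlgebra.
Context {R : realType} (F : hilbertType R).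

Definition star_subalgebra (B : set (F -> F)) : Prop :=
  [/\ B `<=` @bounded_linear R F F,
      @is_subspace R (F -> F) B,
      forall a b, B a -> B b -> B (a \o b)
    & forall a, B a -> B (adjoint a)].

Definition norm_closed (B : set (F -> F)) : Prop :=
  forall a, bounded_linear a ->
    (forall e : R, 0 < e -> exists2 b, B b &
       forall u, `|a u - b u| <= e%:C * `|u|) ->
    B a.

Definition cstar_generated (G : set (F -> F)) : set (F -> F) :=
  smallest [set B | star_subalgebra B /\ norm_closed B] G.

(* States on an operator algebra A containing the identity, as elements of the
   space of functions A -> C with the topology of pointwise convergence; the
   induced topology on [set_type (state_space A)] is the weak-* topology. *)
Definition state_space (A : set (F -> F)) :
    set {ptws set_type A -> R[i]^o} :=
  [set om | [/\
     forall (c : R[i]) (a b s : set_type A),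
       set_val s = c *: set_val a + set_val b -> om s = c * om a + om b,
     forall a s : set_type A,
       set_val s = adjoint (set_val a) \o set_val a -> 0 <= (om s : R[i])
   & forall s : set_type A, set_val s = id -> om s = 1]].

Definition star_hom_to_C (B : set (F -> F)) (chi : (F -> F) -> R[i]) : Prop :=
  [/\ chi id = 1,
      forall c a b, B a -> B b -> chi (c *: a + b) = c * chi a + chi b,
      forall a b, B a -> B b -> chi (a \o b) = chi a * chi b
    & forall a, B a -> chi (adjoint a) = (chi a)^*].

(* *-homomorphism into the *-algebra [cod] of functions on Y, with pointwise
   operations. *)
Definition star_hom_to_fun (B : set (F -> F)) (Y : Type)
    (cod : set (Y -> R[i])) (h : (F -> F) -> Y -> R[i]) : Prop :=
  [/\ forall a, B a -> cod (h a),
      h id = 1,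
      forall c a b, B a -> B b -> h (c *: a + b) = c *: h a + h b,
      forall a b, B a -> B b -> h (a \o b) = h a * h b
    & forall a, B a -> h (adjoint a) = fun y => (h a y)^*].

End OperatorAlgebra.

(* A subspace of C^oo(X), the inclusion being [fun_of]. *)
Record rkhs (R : realType) (d : nat) (X : manifold R d) := Rkhs {
  rkhs_space :> hilbertType R;
  fun_of : rkhs_space -> X -> R[i];
  fun_of_linear : forall (c : R[i]) f g x,
    fun_of (c *: f + g) x = c * fun_of f x + fun_of g x;
  fun_of_inj : injective fun_of;
  fun_of_smooth : forall f, smoothC (fun_of f);
  ksec : X -> rkhs_space;
  reproducing : forall f x, fun_of f x = inner (ksec x) f
}.

Section Rkhs.
Context {R : realType} {d : nat} {X : manifold R d} (V : vector_field X).
Variable H : rkhs X.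

Definition rkernel (x y : X) : R[i] := fun_of (ksec H x) y.

Definition strictly_positive_definite : Prop :=
  forall n (x : 'I_n -> X) (c : 'I_n -> R[i]),
    injective x -> (exists i, c i != 0) ->
    0 < \sum_i \sum_j (c i)^* * c j * rkernel (x i) (x j).

Definition Vdom : set H :=
  [set f | exists g : H, fun_of g = vf_der V (fun_of f)].

Definition Vop (f : H) : H :=
  xget 0 [set g : H | fun_of g = vf_der V (fun_of f)].

Definition Vadj_dom : set H := adjoint_dom Vdom Vop.

Definition Vadj : H -> H := adjoint_on Vdom Vop.

Definition word_norm_sum (n : nat) (f : H) : R[i] :=
  \sum_(e : {ffun 'I_n -> 'I_2})
    `|foldr (fun i g => if e i == 0 then Vop g else Vadj g) f (enum 'I_n)|.

Record analytic_core (Hoo : set H) : Prop := {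
  V_continuous : continuous
    ((fun f : H => vf_der V (fun_of f)) : H -> {compact-open, X -> R[i]^o});
  core_subspace : is_subspace Hoo;
  core_dense : dense Hoo;
  core_dom : Hoo `<=` Vdom `&` Vadj_dom;
  core_V : forall f, Hoo f -> Hoo (Vop f);
  core_Vadj : forall f, Hoo f -> Hoo (Vadj f);
  core_analytic : forall f, Hoo f -> exists2 r : R, 0 < r &
    forall z : R[i], `|z| < r%:C ->
      cvgn (series (fun n => z ^+ n / n`!%:R * word_norm_sum n f)
            : nat -> R[i]^o)
}.

Definition rk_hilbert_algebra (HH : tensor_product H H) : Prop :=
  exists Delta : H -> HH, bounded_linear Delta /\
    forall x, Delta (ksec H x) = tensor HH (ksec H x) (ksec H x).

Definition pointwise_subalgebra (B : set H) : Prop :=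
  is_subspace B /\
  forall f g fg, B f -> B g -> fun_of fg = fun_of f * fun_of g -> B fg.

Definition generating_subspace (Hoo S : set H) : Prop :=
  [/\ is_subspace S, finite_dim S, S `<=` Hoo
    & dense (smallest pointwise_subalgebra S)].

End Rkhs.

Section BoundedFunctions.
Context {R : realType} {d : nat} (X : manifold R d).

Definition Cb : set (X -> R[i]) :=
  [set g | continuous (g : X -> R[i]^o) /\
           exists M : R, forall x, `|g x| <= M%:C].

Definition Cboo : set (X -> R[i]) :=
  [set g | smoothC g /\ exists M : R, forall x, `|g x| <= M%:C].

End BoundedFunctions.

Definition weight {R : realType} (tau p : R) (n : nat) : R :=
  expR (tau * n%:R `^ p).

Section FockStates.
Context {R : realType} {d : nat} {X : manifold R d} {H : rkhs X}.
Context {L : ell2 R} {h : tensor_product L H} {w : nat -> R}.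
Variable F : fock_space h w.

Definition creation (u : h) (a : F) : F :=
  fock_mul (fock_in (vee (fock_power F 1) (fun=> u))) a.

Definition annihilation (u : h) : F -> F := adjoint (creation u).

(* C_c(N) tensored algebraically with Hoo *)
Definition h0 (Hoo : set H) : set h :=
  lin_span [set t | exists c f, [/\ finsupp_seq c, Hoo f & t = tensor h c f]].

Definition A_oo (Hoo : set H) : set (F -> F) :=
  smallest (@star_subalgebra R F)
    ([set id] `|` annihilation @` h0 Hoo).

Definition A_cstar (Hoo : set H) : set (F -> F) := cstar_generated (A_oo Hoo).

Definition Kvec (m : nat) (x : X) : F :=
  limn (fun N => \sum_(m <= n < N)
    ((w n ^- 2)%:C *:
     fock_in (vee (fock_power F n)
                  (fun=> tensor h (ell2_e1 L) (ksec H x))))).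

Definition phi (m : nat) (x : X) (a : F -> F) : R[i] :=
  inner (Kvec m x) (a (Kvec m x)) / `|Kvec m x| ^+ 2.

Definition Psi (x : X) (a : F -> F) : R[i] :=
  limn ((fun m => phi m x a) : nat -> R[i]^o).

Definition Psi_hat (a : F -> F) (x : X) : R[i] := Psi x a.

End FockStates.

Arguments state_space {R F} A _.
Arguments A_oo {R d X H L h w} F Hoo _.
Arguments A_cstar {R d X H L h w} F Hoo _.
Arguments Kvec {R d X H L h w} F m x.
Arguments phi {R d X H L h w} F m x a.
Arguments Psi {R d X H L h w} F x a.
Arguments Psi_hat {R d X H L h w} F a x.
Arguments Cb {R d} X _.
Arguments Cboo {R d} X _.

(* Main.v *)
(* With xi = e_1 (x) k_x and v_n = w(n)^-2, the vectors K_m = sum_(n >= m) v_n xi^n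
   are asymptotic joint eigenvectors of the a_u and their adjoints.  Exactly,
   a_u K_(m+1) = <u, xi> K_m, and K_m - K_(m+1) = v_m xi^m is negligible because
   v_n / v_(n+1) -> 1 makes the tail sum |K_m|^2 dominate its first term.  For the
   creation operator, |a_u^* K_m - c^* K_m|^2 = |a_u^* K_m|^2 - |c|^2 |K_m|^2 with
   c = <u, xi>, and |u \/ xi^n|^2 = (|u|^2 + n |c|^2) / (n + 1) bounds the first term
   by (|c|^2 + o(1)) |K_m|^2.  The bounded operators a such that K_m is an
   asymptotic eigenvector of both a and a^* form a norm-closed star-algebra, on
   which the limit of the vector states is the eigenvalue, hence a character.  It
   equals <u, e_1 (x) k_x> on a_u, which is smooth in x; smoothness passes to
   polynomials and continuity to norm limits. *)
Require Import Defs.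
From HB Require Import structures.
From mathcomp Require Import all_boot all_order all_fingroup all_algebra.
From mathcomp Require Import complex.
From mathcomp Require Import all_classical all_reals all_analysis.
From mathcomp Require Import ring lra.

Set Implicit Arguments.
Unset Strict Implicit.
Unset Printing Implicit Defensive.

Import Order.TTheory GRing.Theory Num.Theory.
Import numFieldNormedType.Exports.

Local Open Scope complex_scope.
Local Open Scope classical_set_scope.
Local Open Scope ring_scope.

(** The untruncated sum [K_0] is already an exact eigenvector of every a_u, because the adjoint for
    the weighted inner product turns the coefficient v_(n+1) into v_n. The obstacle is the creation
    operator: u \/ xi^n is in general no multiple of xi^(n+1), and its excess only fades like |u|^2
    / (n + 1). This forces the passage to tails, and there the a_u become approximate as well. The
    weights meet two opposing demands: v_n must be summable for K_m to exist, and v_n / v_(n+1) must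
    tend to 1 for an index shift to be harmless. With v_n = exp (- 2 tau n^p), the first uses tau, p
    > 0 and the second p < 1. The Fock space estimates know the weights only through positivity and
    these two properties. Tensor powers and [F] are given by axioms, so a vector is identified by
    its inner products with a dense family. Injectivity of the state space embedding is a separate
    matter: on a_u with u = e_1 (x) f the state at x gives <f, k_x>, so by density of [Hoo] it
    determines k_x, and strict positive definiteness recovers x. *)

Section ComplexNorm.
Context {R : realType}.

(** The norm of a complex normed module has values in [R[i]], whose order is partial. Taking the
    real part moves all estimates to the ordered field [R], where [lra] applies. *)
Definition nrm (V : normedZmodType R[i]) (u : V) : R := complex.Re `|u|.

Lemma nrmE (V : normedZmodType R[i]) (u : V) : `|u| = (nrm u)%:C.
Proof. by rewrite /nrm RRe_real // normr_real. Qed.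

Lemma nrm_ge0 (V : normedZmodType R[i]) (u : V) : 0 <= nrm u.
Proof. by rewrite -ler0c -nrmE normr_ge0. Qed.

Lemma nrmD (V : normedZmodType R[i]) (u v : V) : nrm (u + v) <= nrm u + nrm v.
Proof. by rewrite -lecR rmorphD /= -!nrmE ler_normD. Qed.

Lemma nrmN (V : normedZmodType R[i]) (u : V) : nrm (- u) = nrm u.
Proof. by rewrite /nrm normrN. Qed.

Lemma nrmB (V : normedZmodType R[i]) (u v : V) : nrm (u - v) = nrm (v - u).
Proof. by rewrite /nrm distrC. Qed.

Lemma nrm0 (V : normedZmodType R[i]) : nrm (0 : V) = 0.
Proof. by rewrite /nrm normr0. Qed.

Lemma nrm_eq0 (V : normedZmodType R[i]) (u : V) : (nrm u == 0) = (u == 0).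
Proof. by rewrite -(inj_eq (@complexI R)) -nrmE normr_eq0. Qed.

Lemma nrm_gt0 (V : normedZmodType R[i]) (u : V) : (0 < nrm u) = (u != 0).
Proof. by rewrite lt_def nrm_ge0 andbT nrm_eq0. Qed.

Lemma nrm_tri (V : normedZmodType R[i]) (w u v : V) :
  nrm (u - v) <= nrm (u - w) + nrm (w - v).
Proof. by rewrite (le_trans _ (nrmD _ _))// addrA subrK. Qed.

Lemma nrmZ (V : normedModType R[i]) (c : R[i]) (u : V) :
  nrm (c *: u) = nrm c * nrm u.
Proof. by apply: (@complexI R); rewrite rmorphM /= -!nrmE normrZ. Qed.

Lemma nrmM (c d : R[i]) : nrm (c * d) = nrm c * nrm d.
Proof. by apply: (@complexI R); rewrite rmorphM /= -!nrmE normrM. Qed.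

Lemma nrmV (c : R[i]) : nrm c^-1 = (nrm c)^-1.
Proof. by apply: (@complexI R); rewrite fmorphV /= -!nrmE normfV. Qed.

Lemma nrm_real (x : R) : nrm x%:C = `|x|.
Proof. by rewrite /nrm normc_def /= expr0n addr0 sqrtr_sqr. Qed.

Lemma nrmJ (c : R[i]) : nrm c^* = nrm c.
Proof. by case: c => a b; rewrite /nrm !normc_def /= sqrrN. Qed.

Lemma conj_realc (x : R) : (x%:C : R[i])^* = x%:C.
Proof. exact: conjc_real. Qed.

Lemma Re_realM (a : R) (c : R[i]) : complex.Re (a%:C * c) = a * complex.Re c.
Proof. by case: c => b d /=; rewrite mul0r subr0. Qed.

Lemma normc_sq (c : R[i]) : c^* * c = (nrm c ^+ 2)%:C.
Proof.
rewrite rmorphXn /= -nrmE -add_Re2_Im2.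
case: c => a b /=; simpc; apply/eqP; rewrite eq_complex /=.
by apply/andP; split; apply/eqP; ring.
Qed.

Lemma Re_le_nrm (c : R[i]) : complex.Re c <= nrm c.
Proof.
case: c => a b; rewrite /nrm normc_def /=; apply: (le_trans (ler_norm _)).
by rewrite -sqrtr_sqr ler_sqrt ?lerDl ?sqr_ge0// addr_ge0 ?sqr_ge0.
Qed.

Lemma norm_Re_le (c : R[i]) : `|complex.Re c| <= nrm c.
Proof.
case: c => a b; rewrite /nrm normc_def /=.
by rewrite -sqrtr_sqr ler_sqrt ?lerDl ?sqr_ge0// addr_ge0 ?sqr_ge0.
Qed.

Lemma nrm_le_ReIm (c : R[i]) : nrm c <= `|complex.Re c| + `|complex.Im c|.
Proof.
case: c => a b /=.
have -> : a +i* b = a%:C + b%:C * 'i%C by simpc.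
apply: (le_trans (nrmD _ _)); rewrite nrmM !nrm_real.
suff -> : nrm ('i%C : R[i]) = 1 by rewrite mulr1.
by rewrite /nrm normc_def /= expr0n add0r expr1n sqrtr1.
Qed.

Lemma nrm_leP (V W : normedZmodType R[i]) (u : V) (v : W) (M : R) :
  (`|u| <= M%:C * `|v|) = (nrm u <= M * nrm v).
Proof. by rewrite !nrmE -rmorphM /= lecR. Qed.

(** Only real numbers are comparable to 0 in [R[i]], so the complex radii of the topology are in
    fact real epsilons. *)
Lemma lt0c_real (e : R[i]) : 0 < e -> exists2 r : R, 0 < r & e = r%:C.
Proof.
move=> e0; exists (complex.Re e); first by move: e0; rewrite ltcE => /andP[].
by rewrite RRe_real // gtr0_real.
Qed.

Lemma cvg_nrmP (V : normedModType R[i]) (u : nat -> V) (l : V) :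
  u @ \oo --> l <-> forall e : R, 0 < e -> \forall n \near \oo, nrm (u n - l) < e.
Proof.
split.
  move/cvgrPdist_lt => h e e0.
  have := h e%:C; rewrite ltcR => /(_ e0); apply: filterS => n.
  by rewrite nrmE ltcR nrmB.
move=> h; apply/cvgrPdist_lt => e /lt0c_real[r r0 ->].
by apply: filterS (h r r0) => n; rewrite nrmE ltcR nrmB.
Qed.

Lemma cauchy_nrm_cvg (V : completeNormedModType R[i]) (u : nat -> V) :
  (forall e : R, 0 < e -> exists N, forall m n, (N <= m)%N -> (N <= n)%N ->
     nrm (u m - u n) <= e) ->
  exists l : V, u @ \oo --> l.
Proof.
move=> h; suff : cvgn u by move=> /cvg_ex.
apply/(@cauchy_cvgP V (u @ \oo))/cauchy_exP => e /lt0c_real[r r0 ->].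
(* Half the radius, since the hypothesis bounds distances non-strictly and balls are open. *)
have [N hN] := h (r / 2) ltac:(by rewrite divr_gt0).
exists (u N); exists N => // n /= Nn.
rewrite -ball_normE /ball_ /= nrmE ltcR.
by apply: le_lt_trans (hN _ _ _ _) _ => //; rewrite ltr_pdivrMr// ltr_pMr// ltr1n.
Qed.

Lemma nrm_lim_le (V : normedModType R[i]) (u : nat -> V) (l a : V) (M : R) :
  u @ \oo --> l -> (\forall n \near \oo, nrm (u n - a) <= M) -> nrm (l - a) <= M.
Proof.
move=> /cvg_nrmP ul h; apply/ler_addgt0Pr => e e0.
near \oo => n.
apply: le_trans (nrm_tri (u n) _ _) _; rewrite addrC lerD//.
  by near: n.
by rewrite nrmB ltW//; near: n; exact: ul.
Unshelve. all: by end_near. Qed.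

End ComplexNorm.

(** * Inner product identities, Cauchy-Schwarz, continuity *)

Section InnerProduct.
Context {R : realType} {H : hilbertType R}.
Implicit Types u v w : H.

Lemma innerDl u v w : inner (u + v) w = inner u w + inner v w.
Proof. by rewrite innerC innerDr rmorphD /= -!innerC. Qed.

Lemma innerZl c u v : inner (c *: u) v = c^* * inner u v.
Proof. by rewrite innerC innerZr rmorphM /= -innerC. Qed.

Lemma inner0r u : inner u 0 = 0.
Proof. by rewrite -(scale0r (0 : H)) innerZr mul0r. Qed.

Lemma inner0l u : inner 0 u = 0.
Proof. by rewrite innerC inner0r rmorph0. Qed.

Lemma innerNr u v : inner u (- v) = - inner u v.
Proof. by rewrite -scaleN1r innerZr mulN1r. Qed.

Lemma innerNl u v : inner (- u) v = - inner u v.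
Proof. by rewrite innerC innerNr rmorphN /= -innerC. Qed.

Lemma innerBr u v w : inner u (v - w) = inner u v - inner u w.
Proof. by rewrite innerDr innerNr. Qed.

Lemma innerBl u v w : inner (u - v) w = inner u w - inner v w.
Proof. by rewrite innerDl innerNl. Qed.

Lemma inner_sumr (I : Type) (r : seq I) (P : pred I) u (f : I -> H) :
  inner u (\sum_(i <- r | P i) f i) = \sum_(i <- r | P i) inner u (f i).
Proof.
by elim/big_rec2: _ => [|i x y _ <-]; [exact: inner0r|exact: innerDr].
Qed.

Lemma inner_suml (I : Type) (r : seq I) (P : pred I) u (f : I -> H) :
  inner (\sum_(i <- r | P i) f i) u = \sum_(i <- r | P i) inner (f i) u.
Proof.
by elim/big_rec2: _ => [|i x y _ <-]; [exact: inner0l|exact: innerDl].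
Qed.

Lemma inner_nrm u : inner u u = (nrm u ^+ 2)%:C.
Proof. by rewrite inner_norm nrmE rmorphXn. Qed.

Lemma Re_inner_nrm u : complex.Re (inner u u) = nrm u ^+ 2.
Proof. by rewrite inner_nrm. Qed.

Lemma Re_innerC u v : complex.Re (inner v u) = complex.Re (inner u v).
Proof. by rewrite innerC; case: (inner u v). Qed.

Lemma nrm_sqD u v :
  nrm (u + v) ^+ 2 = nrm u ^+ 2 + 2 * complex.Re (inner u v) + nrm v ^+ 2.
Proof.
rewrite -!Re_inner_nrm innerDl !innerDr !raddfD /= (Re_innerC u v); ring.
Qed.

Lemma nrm_sqB u v :
  nrm (u - v) ^+ 2 = nrm u ^+ 2 - 2 * complex.Re (inner u v) + nrm v ^+ 2.
Proof. by rewrite nrm_sqD innerNr nrmN raddfN /= mulrN. Qed.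

Lemma inner_ext u v : (forall w, inner u w = inner v w) -> u = v.
Proof.
move=> h; apply/eqP; rewrite -subr_eq0 -nrm_eq0 -sqrf_eq0 -Re_inner_nrm.
by rewrite innerBl h subrr.
Qed.

Lemma cauchy_schwarz u v : nrm (inner u v) <= nrm u * nrm v.
Proof.
have [->|v0] := eqVneq v 0; first by rewrite inner0r !nrm0 mulr0.
have nv : 0 < nrm v by rewrite nrm_gt0.
(* expand |u - t v|^2 >= 0 at the minimiser t = <v, u> / |v|^2 *)
have key : nrm (inner u v) ^+ 2 <= (nrm u * nrm v) ^+ 2.
  have := sqr_ge0 (nrm (u - ((nrm v ^+ 2)^-1%:C * inner v u) *: v)).
  rewrite nrm_sqB nrmZ nrmM nrm_real innerZr -mulrA (innerC u v) normc_sq.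
  rewrite -rmorphM /= nrmJ ger0_norm ?invr_ge0 ?sqr_ge0//.
  move=> h; rewrite exprMn -ler_pdivrMr ?exprn_gt0//.
  rewrite -subr_ge0; apply: le_trans h _; rewrite le_eqVlt; apply/orP; left.
  apply/eqP; field; exact: lt0r_neq0.
by rewrite -ler_sqr// nnegrE ?mulr_ge0 ?nrm_ge0.
Qed.

Lemma parallelogram u v :
  nrm (u - v) ^+ 2 = 2 * nrm u ^+ 2 + 2 * nrm v ^+ 2 - nrm (u + v) ^+ 2.
Proof. rewrite nrm_sqB nrm_sqD; ring. Qed.

Lemma cvg_innerr (u : nat -> H) l v : u @ \oo --> l ->
  (fun n => inner v (u n) : R[i]^o) @ \oo --> (inner v l : R[i]^o).
Proof.
move=> /cvg_nrmP ul; apply/cvg_nrmP => e e0.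
have d0 : 0 < e / (nrm v + 1) by rewrite divr_gt0// ltr_wpDl// nrm_ge0.
apply: filterS (ul _ d0) => n; rewrite ltr_pdivlMr; last first.
  by rewrite ltr_wpDl// nrm_ge0.
rewrite -innerBr; apply: le_lt_trans; apply: le_trans (cauchy_schwarz _ _) _.
by rewrite mulrC ler_wpM2l ?nrm_ge0// lerDl.
Qed.

Lemma cvg_nrm (u : nat -> H) l : u @ \oo --> l ->
  (fun n => nrm (u n)) @ \oo --> nrm l.
Proof.
move=> /cvg_nrmP ul; apply/cvgrPdist_lt => e e0.
apply: filterS (ul _ e0) => n; apply: le_lt_trans; rewrite ler_norml.
apply/andP; split.
  by rewrite lerBrDr addrC lerBlDr (le_trans _ (nrmD _ _))// addrC subrK.
by rewrite lerBlDr nrmB (le_trans _ (nrmD _ _))// subrK.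
Qed.

End InnerProduct.

Lemma bounded_linearP (R : realType) (E F : normedModType R[i]) (T : E -> F) :
  bounded_linear T <->
  linear T /\ exists2 M : R, 0 <= M & forall u, nrm (T u) <= M * nrm u.
Proof.
split=> [[lT [M hM]]|[lT [M M0 hM]]]; split=> //.
  exists `|M| => // u; apply: (@le_trans _ _ (M * nrm u)).
    by rewrite -nrm_leP.
  by rewrite ler_wpM2r ?nrm_ge0// ler_norm.
by exists M => u; rewrite nrm_leP.
Qed.

Section LinearMaps.
Context {R : realType} {E F : lmodType R[i]} (T : E -> F).
Hypothesis lT : linear T.

Lemma lin0 : T 0 = 0.
Proof. by have := lT (-1) 0 0; rewrite scaler0 addr0 scaleN1r addNr. Qed.

Lemma linD u v : T (u + v) = T u + T v.
Proof. by have := lT 1 u v; rewrite !scale1r. Qed.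

Lemma linZ c u : T (c *: u) = c *: T u.
Proof. by have := lT c u 0; rewrite lin0 !addr0. Qed.

Lemma linB u v : T (u - v) = T u - T v.
Proof. by rewrite linD -scaleN1r linZ scaleN1r. Qed.

Lemma lin_sum (I : Type) (r : seq I) (P : pred I) (f : I -> E) :
  T (\sum_(i <- r | P i) f i) = \sum_(i <- r | P i) T (f i).
Proof. by elim/big_rec2: _ => [|i x y _ <-]; [exact: lin0|exact: linD]. Qed.

End LinearMaps.

(** * Riesz representation and adjoints of bounded operators *)

Section Riesz.
Context {R : realType} {H : hilbertType R}.

(* The representing vector minimises |u|^2 - 2 Re (f u). *)
Theorem riesz (f : H -> R[i]^o) : bounded_linear f ->
  exists u : H, forall v, f v = inner u v.
Proof.
move=> /bounded_linearP[lf [M M0 hM]].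
pose J (u : H) : R := nrm u ^+ 2 - 2 * complex.Re (f u).
have Jlb u : - M ^+ 2 <= J u.
  rewrite /J; have := le_trans (Re_le_nrm (f u)) (hM u).
  have := sqr_ge0 (nrm u - M); rewrite sqrrB; lra.
pose S := [set J u | u in setT].
have Sinf : has_inf S.
  by split; [exists (J 0), 0|exists (- M ^+ 2) => _ [u _ <-]].
have Jinf u : inf S <= J u by apply: ge_inf; [exact: (Sinf.2)|exists u].
have /choice[u hu] : forall n : nat, exists u, J u < inf S + n.+1%:R^-1.
  move=> n.
  have [] := @inf_adherent _ S n.+1%:R^-1 _ Sinf; first by rewrite invr_gt0.
  by move=> _ [x _ <-] h; exists x.
(* The midpoint of [x] and [y] still has [J] at least [inf S], so by the parallelogram law two
   near-minimisers are close and a minimising sequence is Cauchy. *)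
have par x y : nrm (x - y) ^+ 2 <= 2 * (J x + J y) - 4 * inf S.
  have := Jinf ((2^-1)%:C *: (x + y)).
  rewrite /J parallelogram nrmZ nrm_real (linZ lf) (linD lf).
  have -> : ((2^-1)%:C : R[i]) *: (f x + f y) = (2^-1)%:C * (f x + f y) by [].
  rewrite Re_realM raddfD /=.
  rewrite ger0_norm ?invr_ge0// exprMn.
  have -> : (2^-1 : R) ^+ 2 = 4^-1 by field.
  move: (inf S) (nrm (x + y) ^+ 2) (nrm x ^+ 2) (nrm y ^+ 2) => i a b c.
  move: (complex.Re _) (complex.Re _) => r r'; lra.
have [l ul] : exists l : H, u @ \oo --> l.
  apply: cauchy_nrm_cvg => e e0.
  have e2 : 0 < e ^+ 2 / 4 by rewrite divr_gt0 ?exprn_gt0.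
  have [N _ hN] : \forall n \near \oo, n.+1%:R^-1 < e ^+ 2 / 4.
    have := @cvg_harmonic R; move/cvgrPdist_lt => /(_ _ e2).
    by apply: filterS => n; rewrite sub0r normrN ger0_norm ?invr_ge0.
  exists N => m n Nm Nn.
  rewrite -ler_sqr ?nnegrE ?nrm_ge0 ?(ltW e0)//.
  apply: le_trans (par _ _) _.
  have /= hm := hN _ Nm; have /= hn := hN _ Nn.
  move: hm hn (hu m) (hu n); move: (J _) (J _) (inf S) (e ^+ 2) => a b c q.
  move: (m.+1%:R^-1) (n.+1%:R^-1) => r s. lra.
have Jl : J l <= inf S.
  have fl : (fun n => J (u n)) @ \oo --> J l.
    apply: cvgB.
      by rewrite expr2; under eq_fun do rewrite expr2; apply: cvgM; exact: cvg_nrm.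
    apply: cvgM; first exact: cvg_cst.
    apply/cvgrPdist_le => e e0.
    have d0 : 0 < e / (M + 1) by rewrite divr_gt0// ltr_wpDl.
    move/cvg_nrmP: ul => /(_ _ d0); apply: filterS => n h.
    rewrite -raddfB /= -(linB lf); apply: le_trans (norm_Re_le _) _.
    apply: le_trans (hM _) _.
    move: h; rewrite ltr_pdivlMr ?ltr_wpDl// mulrDr mulr1 nrmB => h.
    have := nrm_ge0 (l - u n); lra.
  have g : (fun n => inf S + n.+1%:R^-1) @ \oo --> inf S + 0.
    by apply: cvgD; [exact: cvg_cst|exact: cvg_harmonic].
  rewrite addr0 in g; apply: (ler_cvg_to fl g).
  by apply: nearW => n; exact: ltW.
have var v : complex.Re (f v) = complex.Re (inner l v).
  set b := complex.Re (inner l v) - complex.Re (f v).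
  have ht (t : R) : 0 <= 2 * t * b + t ^+ 2 * nrm v ^+ 2.
    have := le_trans Jl (Jinf (l + t%:C *: v)).
    rewrite /J nrm_sqD (linD lf) (linZ lf) nrmZ innerZr nrm_real exprMn.
    rewrite real_normK ?num_real//.
    have -> : complex.Re (f l + t%:C *: f v) =
              complex.Re (f l) + t * complex.Re (f v).
      have -> : t%:C *: f v = t%:C * f v by [].
      by rewrite raddfD /= Re_realM.
    rewrite Re_realM.
    rewrite /b; lra.
  have n1 : 0 < nrm v ^+ 2 + 1 by rewrite ltr_wpDl// sqr_ge0.
  suff : b = 0 by rewrite /b => /eqP; rewrite subr_eq0 => /eqP.
  (* First variation at the minimiser: a suitable [t] makes the quadratic in [ht] a negative
     multiple of [b ^+ 2]. The [+ 1] keeps the quotient meaningful when [v = 0]. *)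
  have := ht (- b / (nrm v ^+ 2 + 1)).
  move: (nrm v ^+ 2) (sqr_ge0 (nrm v)) n1 => n n0 n1.
  have -> : 2 * (- b / (n + 1)) * b + (- b / (n + 1)) ^+ 2 * n =
            - (b ^+ 2 * ((n + 2) / (n + 1) ^+ 2)) by field; exact: lt0r_neq0.
  rewrite oppr_ge0 pmulr_lle0 => [h|]; last first.
    by rewrite divr_gt0 ?exprn_gt0// ltr_wpDl.
  by apply/eqP; rewrite -sqrf_eq0 eq_le h sqr_ge0.
exists l => v; apply/eqP; rewrite eq_complex var eqxx /=.
(* Real parts suffice: Re (i z) = - Im z, so the imaginary parts are compared at [i v]. *)
have := var ('i%C *: v); rewrite (linZ lf) innerZr.
have -> : 'i%C *: f v = f v * 'i%C by rewrite mulrC.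
by rewrite (mulrC 'i%C) !ReiNIm => /oppr_inj ->.
Qed.

End Riesz.

Section Adjoint.
Context {R : realType} {H : hilbertType R}.
Implicit Types (S T : H -> H).

(** [adjoint] picks a representing vector and falls back on 0; Riesz shows that the fallback never
    occurs for bounded [T]. *)
Lemma adjointP T : bounded_linear T ->
  forall u v, inner u (T v) = inner (adjoint T u) v.
Proof.
move=> bT u v; have [lT [M M0 hM]] := (bounded_linearP T).1 bT.
have [u' hu'] : exists u' : H, forall v, inner u (T v) = inner u' v.
  apply: (@riesz _ _ (fun v => inner u (T v) : R[i]^o)).
  apply/bounded_linearP; split=> [c a b|]; first by rewrite lT innerDr innerZr.
  exists (nrm u * M) => [|a]; first by rewrite mulr_ge0 ?nrm_ge0.
  apply: le_trans (cauchy_schwarz _ _) _.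
  by rewrite -mulrA ler_wpM2l ?nrm_ge0.
rewrite /adjoint /adjoint_on; case: xgetP => [w _ /= ->//|/(_ u')] //=.
Qed.

Lemma adjointPl T : bounded_linear T ->
  forall u v, inner (T u) v = inner u (adjoint T v).
Proof. by move=> bT u v; rewrite innerC (adjointP bT) -innerC. Qed.

Lemma adjoint_uniq T T' : bounded_linear T ->
  (forall u v, inner u (T v) = inner (T' u) v) -> adjoint T = T'.
Proof.
move=> bT h; apply/funext => u; apply: inner_ext => v.
by rewrite -(adjointP bT) h.
Qed.

(** Cauchy-Schwarz for <u, T w> with w the adjoint applied to [u], then division by |w|. Keeping the
    same constant [M] lets norm approximations pass to adjoints. *)
Lemma adjoint_bound T M : bounded_linear T ->
  (forall u, nrm (T u) <= M * nrm u) ->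
  forall u, nrm (adjoint T u) <= M * nrm u.
Proof.
move=> bT hM u; have [->|n0] := eqVneq (adjoint T u) 0.
  by rewrite nrm0; apply: le_trans (hM u); exact: nrm_ge0.
rewrite -(@ler_pM2r _ (nrm (adjoint T u))) ?nrm_gt0//.
rewrite -expr2 -Re_inner_nrm -(adjointP bT).
apply: le_trans (Re_le_nrm _) _; apply: le_trans (cauchy_schwarz _ _) _.
rewrite mulrAC mulrC ler_wpM2r ?nrm_ge0//; exact: hM.
Qed.

Lemma adjoint_bounded T : bounded_linear T -> bounded_linear (adjoint T).
Proof.
move=> bT; have [lT [M M0 hM]] := (bounded_linearP T).1 bT.
apply/bounded_linearP; split.
  move=> c u v; apply: inner_ext => w.
  by rewrite -(adjointP bT) !innerDl !innerZl !(adjointP bT).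
by exists M => //; exact: adjoint_bound.
Qed.

Lemma adjointK T : bounded_linear T -> adjoint (adjoint T) = T.
Proof.
move=> bT; apply: adjoint_uniq (adjoint_bounded bT) _ => u v.
by rewrite -(adjointPl bT).
Qed.

Lemma bounded_linear_id : bounded_linear (id : H -> H).
Proof.
by apply/bounded_linearP; split=> //; exists 1 => // u; rewrite mul1r.
Qed.

Lemma bounded_linear_lc c S T : bounded_linear S -> bounded_linear T ->
  @bounded_linear R H H (c *: S + T).
Proof.
move=> /bounded_linearP[lS [M M0 hM]] /bounded_linearP[lT [N N0 hN]].
apply/bounded_linearP; split.
  move=> d u v; rewrite !fctE lS lT !scalerDr !scalerA (mulrC c) -!addrA.
  by congr (_ + _); rewrite addrCA.
exists (nrm c * M + N) => [|u]; first by rewrite addr_ge0 ?mulr_ge0 ?nrm_ge0.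
rewrite !fctE; apply: le_trans (nrmD _ _) _; rewrite nrmZ mulrDl -mulrA.
by rewrite lerD ?ler_wpM2l ?nrm_ge0.
Qed.

Lemma bounded_linear_comp S T : bounded_linear S -> bounded_linear T ->
  bounded_linear (S \o T).
Proof.
move=> /bounded_linearP[lS [M M0 hM]] /bounded_linearP[lT [N N0 hN]].
apply/bounded_linearP; split=> [c u v /=|]; first by rewrite lT lS.
exists (M * N) => [|u /=]; first by rewrite mulr_ge0.
by apply: le_trans (hM _) _; rewrite -mulrA ler_wpM2l.
Qed.

Lemma bounded_linear0 : @bounded_linear R H H 0.
Proof.
apply/bounded_linearP; split=> [c u v|]; first by rewrite scaler0 addr0.
by exists 0 => // u; rewrite nrm0 mul0r.
Qed.

Lemma adjoint_lc c S T : bounded_linear S -> bounded_linear T ->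
  @adjoint R H (c *: S + T) = c^* *: adjoint S + adjoint T.
Proof.
move=> bS bT; apply: adjoint_uniq; first exact: bounded_linear_lc.
move=> u v; rewrite !fctE innerDr innerZr innerDl innerZl conjCK.
by rewrite !adjointP.
Qed.

Lemma adjoint_comp S T : bounded_linear S -> bounded_linear T ->
  adjoint (S \o T) = adjoint T \o adjoint S.
Proof.
move=> bS bT; apply: adjoint_uniq; first exact: bounded_linear_comp.
by move=> u v /=; rewrite !adjointP.
Qed.

Lemma adjoint_id : adjoint (id : H -> H) = id.
Proof. exact: adjoint_uniq bounded_linear_id _. Qed.

Lemma adjoint0 : @adjoint R H 0 = 0.
Proof.
by apply: adjoint_uniq bounded_linear0 _ => u v; rewrite inner0r inner0l.
Qed.

End Adjoint.

(** * The norm-closed star-algebra attached to a sequence of approximate eigenvectors *)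

Section ApproximateEigenvectors.
Context {R : realType} {H : hilbertType R} (K : nat -> H).
Hypothesis K_neq0 : forall m, K m != 0.

(** The error is relative to [nrm (K m)], because in the application these norms tend to 0. *)
Definition approx_eig (a : H -> H) (c : R[i]) : Prop :=
  forall e : R, 0 < e ->
    \forall m \near \oo, nrm (a (K m) - c *: K m) <= e * nrm (K m).

Let nK m : 0 < nrm (K m). Proof. by rewrite nrm_gt0. Qed.

Lemma approx_eig_lc z a b c d : approx_eig a c -> approx_eig b d ->
  approx_eig (z *: a + b) (z * c + d).
Proof.
move=> ha hb e e0.
(* The [+ 1] keeps the denominator positive when [z = 0]; the same device recurs below. *)
have d0 : 0 < e / (2 * (nrm z + 1)).
  by rewrite divr_gt0// mulr_gt0// ltr_wpDl// nrm_ge0.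
have e2 : 0 < e / 2 by rewrite divr_gt0.
apply: filterS2 (ha _ d0) (hb _ e2) => m h1 h2.
rewrite !fctE.
have -> : z *: a (K m) + b (K m) - (z * c + d) *: K m =
    z *: (a (K m) - c *: K m) + (b (K m) - d *: K m).
  by rewrite scalerDl scalerBr scalerA opprD addrACA.
apply: le_trans (nrmD _ _) _; rewrite nrmZ.
have : nrm z * nrm (a (K m) - c *: K m) <= e / 2 * nrm (K m).
  apply: le_trans (_ : nrm z * (e / (2 * (nrm z + 1)) * nrm (K m)) <= _).
    by rewrite ler_wpM2l ?nrm_ge0.
  rewrite mulrA ler_wpM2r ?nrm_ge0//.
  have z1 : 0 < nrm z + 1 by rewrite ltr_wpDl// nrm_ge0.
  have -> : nrm z * (e / (2 * (nrm z + 1))) = e / 2 * (nrm z / (nrm z + 1)).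
    by field; exact: lt0r_neq0.
  by rewrite ler_piMr ?(ltW e2)// ler_pdivrMr// mul1r lerDl.
lra.
Qed.

Lemma approx_eig_id : approx_eig id 1.
Proof.
move=> e e0; apply: nearW => m; rewrite scale1r subrr nrm0.
by rewrite mulr_ge0 ?nrm_ge0 ?ltW.
Qed.

Lemma approx_eig0 : approx_eig 0 0.
Proof.
move=> e e0; apply: nearW => m; rewrite scale0r subrr nrm0.
by rewrite mulr_ge0 ?nrm_ge0 ?ltW.
Qed.

(** Boundedness of the outer operator carries the error of [b] through [a], and the scalar [d] then
    comes out by linearity. This is the source of multiplicativity of the limit states. *)
Lemma approx_eig_comp a b c d : bounded_linear a ->
  approx_eig a c -> approx_eig b d -> approx_eig (a \o b) (c * d).
Proof.
move=> /bounded_linearP[la [M M0 hM]] ha hb e e0.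
have d0 : 0 < e / (2 * (nrm d + 1)).
  by rewrite divr_gt0// mulr_gt0// ltr_wpDl// nrm_ge0.
have m0 : 0 < e / (2 * (M + 1)) by rewrite divr_gt0// mulr_gt0// ltr_wpDl.
apply: filterS2 (ha _ d0) (hb _ m0) => m h1 h2 /=.
have -> : a (b (K m)) - (c * d) *: K m =
    a (b (K m) - d *: K m) + d *: (a (K m) - c *: K m).
  by rewrite (linB la) (linZ la) scalerBr scalerA (mulrC d) addrA subrK.
apply: le_trans (nrmD _ _) _; rewrite nrmZ.
have half (x y : R) : 0 <= x -> y <= e / (2 * (x + 1)) * nrm (K m) ->
    x * y <= e / 2 * nrm (K m).
  move=> x0 hy; have x1 : 0 < x + 1 by rewrite ltr_wpDl.
  apply: le_trans (_ : x * (e / (2 * (x + 1)) * nrm (K m)) <= _).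
    by rewrite ler_wpM2l.
  rewrite mulrA ler_wpM2r ?nrm_ge0//.
  have -> : x * (e / (2 * (x + 1))) = e / 2 * (x / (x + 1)).
    by field; exact: lt0r_neq0.
  by rewrite ler_piMr ?divr_ge0 ?(ltW e0)// ler_pdivrMr// mul1r lerDl.
have := half _ _ (nrm_ge0 d) h1; have := half _ _ M0 h2.
have := hM (b (K m) - d *: K m); lra.
Qed.

Lemma approx_eig_inner a c : approx_eig a c ->
  (fun m => inner (K m) (a (K m)) / `|K m| ^+ 2 : R[i]^o) @ \oo
    --> (c : R[i]^o).
Proof.
move=> ha; apply/cvg_nrmP => e e0.
have e2 : 0 < e / 2 by rewrite divr_gt0.
apply: filterS (ha _ e2) => m h.
have -> : inner (K m) (a (K m)) / `|K m| ^+ 2 - c =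
          inner (K m) (a (K m) - c *: K m) / `|K m| ^+ 2.
  rewrite innerBr innerZr inner_norm; field.
  by rewrite normr_eq0.
rewrite nrmM nrmV nrmE -rmorphXn nrm_real ger0_norm ?exprn_ge0 ?nrm_ge0//.
rewrite ltr_pdivrMr ?exprn_gt0//; apply: le_lt_trans (cauchy_schwarz _ _) _.
rewrite expr2 mulrCA ltr_pM2l//; apply: le_lt_trans h _.
by rewrite ltr_pM2r// ltr_pdivrMr// ltr_pMr// ltr1n.
Qed.

(** Serves twice: it makes the eigenvalues of a norm-convergent sequence of operators Cauchy, and it
    bounds [Psi_hat a] uniformly over [X]. *)
Lemma approx_eig_bound a c M : (forall u, nrm (a u) <= M * nrm u) ->
  approx_eig a c -> nrm c <= M.
Proof.
move=> hM ha; apply/ler_addgt0Pr => e e0.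
have [m _ /(_ m (leqnn m)) /= h] := ha _ e0.
rewrite -(@ler_pM2r _ (nrm (K m)))// -nrmZ.
have -> : c *: K m = a (K m) - (a (K m) - c *: K m) by rewrite subKr.
apply: le_trans (nrmD _ _) _; rewrite nrmN mulrDl lerD//.
Qed.

Lemma approx_eig_lim a c :
  (forall e : R, 0 < e -> exists b d, [/\ approx_eig b d,
     forall u, nrm (a u - b u) <= e * nrm u & nrm (d - c) <= e]) ->
  approx_eig a c.
Proof.
move=> h e e0; have e3 : 0 < e / 3 by rewrite divr_gt0.
have [b [d [hb hab hdc]]] := h _ e3.
apply: filterS (hb _ e3) => m hm.
have -> : a (K m) - c *: K m =
    (a (K m) - b (K m)) + (b (K m) - d *: K m) + (d - c) *: K m.
  by rewrite scalerBl addrA (addrA (a (K m) - b (K m))) !subrK.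
apply: le_trans (nrmD _ _) _; rewrite nrmZ.
have := nrmD (a (K m) - b (K m)) (b (K m) - d *: K m).
have : nrm (d - c) * nrm (K m) <= e / 3 * nrm (K m).
  by rewrite ler_wpM2r ?nrm_ge0.
have := hab (K m); lra.
Qed.

(** The clause on [adjoint a] is a real constraint: an approximate eigenvector of a non-normal
    operator need not be one of its adjoint. It makes the set closed under adjoints. *)
Definition eig_algebra : set (H -> H) :=
  [set a | bounded_linear a /\
     exists c, approx_eig a c /\ approx_eig (adjoint a) c^*].

Lemma eig_algebra_star : star_subalgebra eig_algebra.
Proof.
split.
- by move=> a [].
- split.
    split; first exact: bounded_linear0.
    exists 0; rewrite adjoint0 conjC0; split; exact: approx_eig0.
  move=> z a b [ba [c [ac ac']]] [bb [d [bd bd']]].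
  split; first exact: bounded_linear_lc.
  exists (z * c + d); split; first exact: approx_eig_lc.
  by rewrite adjoint_lc// rmorphD rmorphM; exact: approx_eig_lc.
- move=> a b [ba [c [ac ac']]] [bb [d [bd bd']]].
  split; first exact: bounded_linear_comp.
  exists (c * d); split; first exact: approx_eig_comp.
  rewrite adjoint_comp// rmorphM /= mulrC.
  exact: approx_eig_comp (adjoint_bounded bb) _ _.
- move=> a [ba [c [ac ac']]]; split; first exact: adjoint_bounded.
  by exists c^*; rewrite conjCK adjointK.
Qed.

Lemma eig_algebra_id : eig_algebra id.
Proof.
split; first exact: bounded_linear_id.
by exists 1; rewrite adjoint_id conjC1; split; exact: approx_eig_id.
Qed.

(** If b_n approximates [a], then b_m - b_n is small in norm, hence so is c_m - c_n by
    [approx_eig_bound]. The limit of the c_n is the eigenvalue of [a], and [adjoint_bound] transfers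
    the approximation to the adjoints. *)
Lemma eig_algebra_closed : norm_closed eig_algebra.
Proof.
move=> a ba hcl.
have e_gt0 n : 0 < n.+1%:R^-1 :> R by rewrite invr_gt0.
have e_cvg (e : R) : 0 < e -> exists N, forall n, (N <= n)%N -> n.+1%:R^-1 < e.
  move=> e0; have := @cvg_harmonic R; move/cvgrPdist_lt => /(_ _ e0) [N _ hN].
  exists N => n /hN /=; rewrite sub0r normrN ger0_norm ?invr_ge0//.
have /choice[bc hbc] : forall n : nat, exists bc : (H -> H) * R[i],
    [/\ bounded_linear bc.1, approx_eig bc.1 bc.2,
        approx_eig (adjoint bc.1) bc.2^*
      & forall u, nrm (a u - bc.1 u) <= n.+1%:R^-1 * nrm u].
  move=> n; have [b [bb [c [bc bc']]] hb] := hcl _ (e_gt0 n).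
  by exists (b, c); split=> // u; rewrite -nrm_leP.
pose b n := (bc n).1; pose c n := (bc n).2.
have bb n : bounded_linear (b n) by have [] := hbc n.
have ac n : approx_eig (b n) (c n) by have [] := hbc n.
have ac' n : approx_eig (adjoint (b n)) (c n)^* by have [] := hbc n.
have hb n u : nrm (a u - b n u) <= n.+1%:R^-1 * nrm u by have [_ _ _] := hbc n.
have ccauchy m n : nrm (c m - c n) <= m.+1%:R^-1 + n.+1%:R^-1.
  apply: (@approx_eig_bound (-1 *: b n + b m)); last first.
    have -> : c m - c n = -1 * c n + c m by rewrite mulN1r addrC.
    exact: approx_eig_lc (ac n) (ac m).
  move=> u; rewrite !fctE scaleN1r addrC.
  apply: le_trans (nrm_tri (a u) _ _) _; rewrite mulrDl nrmB.
  by rewrite lerD.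
(* completeness of the complex plane, seen as a line of [H] *)
have [l cl] : exists l : R[i]^o, (c : nat -> R[i]^o) @ \oo --> l.
  have [v v1] : exists v : H, inner v v = 1.
    exists ((nrm (K 0%N))^-1%:C *: K 0%N).
    rewrite inner_nrm nrmZ nrm_real ger0_norm ?invr_ge0 ?nrm_ge0//.
    by rewrite mulVf ?expr1n// lt0r_neq0.
  have nv : nrm v = 1.
    apply/eqP; rewrite -(@eqrXn2 _ 2%N) ?nrm_ge0// expr1n -Re_inner_nrm.
    by rewrite v1.
  have [w vw] : exists w : H, (fun n => c n *: v) @ \oo --> w.
    apply: cauchy_nrm_cvg => e e0.
    have e2 : 0 < e / 2 by rewrite divr_gt0.
    have [N hN] := e_cvg _ e2; exists N => m n /hN hm /hN hn.
    rewrite -scalerBl nrmZ nv mulr1; apply: le_trans (ccauchy m n) _.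
    by rewrite [e]splitr lerD// ltW.
  exists (inner v w); move: (@cvg_innerr _ _ _ _ v vw).
  by under eq_fun do rewrite innerZr v1 mulr1.
have hdist (n : nat) : nrm (c n - l) <= n.+1%:R^-1.
  rewrite nrmB; apply/ler_addgt0Pr => e e0.
  apply: (nrm_lim_le cl); have [N hN] := e_cvg _ e0.
  exists N => // m /= /hN hm; apply: le_trans (ccauchy m n) _.
  by rewrite addrC lerD2l ltW.
split=> //; exists l; split; apply: approx_eig_lim => e;
  move=> /e_cvg[N /(_ N (leqnn _)) /ltW hN].
  exists (b N), (c N); split=> //; last exact: le_trans (hdist N) hN.
  by move=> u; apply: le_trans (hb N u) _; rewrite ler_wpM2r ?nrm_ge0.
exists (adjoint (b N)), (c N)^*; split=> //; last first.
  rewrite -rmorphB; apply: le_trans hN; apply: le_trans (hdist N).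
  by rewrite nrmJ.
move=> u.
have -> : adjoint a u - adjoint (b N) u = adjoint (-1 *: b N + a) u.
  by rewrite adjoint_lc// rmorphN rmorph1 !fctE scaleN1r addrC.
apply: adjoint_bound; first exact: bounded_linear_lc.
move=> v; rewrite !fctE scaleN1r addrC; apply: le_trans (hb N v) _.
by rewrite ler_wpM2r ?nrm_ge0.
Qed.

End ApproximateEigenvectors.

(** * Spans, density and symmetric tensors *)

Section LinSpan.
Context {R : realType} {E : lmodType R[i]}.

Lemma sub_lin_span (A : set E) : A `<=` lin_span A.
Proof. exact: sub_gen_smallest. Qed.

Lemma lin_span_min (A B : set E) : is_subspace B -> A `<=` B -> lin_span A `<=` B.
Proof. by move=> sB AB; exact: smallest_sub. Qed.

Lemma lin_span_subspace (A : set E) : is_subspace (lin_span A).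
Proof.
split=> [B [[B0 _] _] //|c u v Au Av B [sB AB]].
by apply: sB.2; [apply: Au|apply: Av].
Qed.

End LinSpan.

Lemma nrm_near (R : realType) (V : normedModType R[i]) (A : set V) (s : V) :
  closure A s -> forall e : R, 0 < e -> exists2 t, A t & nrm (s - t) < e.
Proof.
move=> cA e e0; have e0' : (0 : R[i]) < e%:C by rewrite ltcR.
have [t [At]] := cA _ (nbhsx_ballx s _ e0').
by rewrite -ball_normE /ball_ /= nrmE ltcR => h; exists t.
Qed.

Lemma dense_near (R : realType) (V : normedModType R[i]) (A : set V) (s : V) :
  dense A -> forall e : R, 0 < e -> exists2 t, A t & nrm (s - t) < e.
Proof.
move=> dA e e0; apply: nrm_near e0 => B /nbhs_interior nB.
have [|t [/interior_subset Bt At]] := dA B^° _ (@open_interior _ B).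
  by exists s; exact: nbhs_singleton.
by exists t.
Qed.

(** The difference is orthogonal to the span, so no point of the span is closer to it than 0 is.
    Density would give a point at distance less than |u - v|, unless [u = v]. *)
Lemma dense_inner_ext (R : realType) (H : hilbertType R) (A : set H) (u v : H) :
  dense (lin_span A) -> (forall a, A a -> inner u a = inner v a) -> u = v.
Proof.
move=> dA h; apply/eqP; rewrite -subr_eq0 -nrm_eq0; apply/negP => /negP n0.
have {n0}n0 : 0 < nrm (u - v) by rewrite lt_def n0 nrm_ge0.
have [t spt] := dense_near (u - v) dA n0.
have : inner (u - v) t = 0.
  move: t spt; apply: lin_span_min.
    split=> [|c a b /= ha hb]; first exact: inner0r.
    by rewrite innerDr innerZr ha hb mulr0 addr0.
  by move=> a /h /=; rewrite innerBl => ->; rewrite subrr.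
move=> ht; rewrite ltNge => /negP; apply.
rewrite -ler_sqr ?nnegrE ?nrm_ge0// (nrm_sqB (u - v)) ht mulr0 subr0 lerDl.
exact: sqr_ge0.
Qed.

Section SymmetricTensors.
Context {R : realType} {H : hilbertType R} {n : nat} (T : tensor_power H n).

(** The right side is the permanent of the matrix of inner products, divided by n!. Each summand of
    the double sum over [s], [t] depends only on [s^-1 * t], so one of the two factors 1/n! is
    absorbed. *)
Lemma vee_inner (u v : 'I_n -> H) :
  inner (vee T u) (vee T v) =
  (n`!%:R)^-1 * \sum_(s : 'S_n) \prod_i inner (u i) (v (s i)).
Proof.
rewrite /vee innerZl innerZr inner_suml.
under eq_bigr => s _.
  rewrite inner_sumr.
  under eq_bigr => t _.
    rewrite tensorn_inner (reindex_inj (@perm_inj _ s^-1)) /=.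
    under eq_bigr => i _ do rewrite permKV -permM.
    over.
  rewrite (reindex_inj (mulgI s)) /=.
  under eq_bigr => t _ do under eq_bigr => i _ do rewrite mulKg.
  over.
rewrite sumr_const card_Sn.
rewrite rmorphV ?unitfE ?pnatr_eq0 -?lt0n ?fact_gt0// rmorph_nat.
rewrite -[X in _ * (_ * X)]mulr_natl (mulrA n`!%:R^-1 n`!%:R) mulVf ?mul1r//.
Qed.

Lemma vee_const_inner (x : H) (v : 'I_n -> H) :
  inner (vee T (fun=> x)) (vee T v) = \prod_i inner x (v i).
Proof.
have hs (s : 'S_n) : \prod_i inner x (v (s i)) = \prod_i inner x (v i).
  by rewrite [RHS](reindex_inj (@perm_inj _ s)).
rewrite vee_inner (eq_bigr _ (fun s _ => hs s)).
rewrite sumr_const card_Sn -[X in _ * X]mulr_natl mulrA mulVf ?mul1r//.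
Qed.

Lemma sym_power_span : lin_span (range (vee T)) `<=` sym_power T.
Proof. exact: subset_closure. Qed.

Lemma sym_power_vee (u : 'I_n -> H) : sym_power T (vee T u).
Proof. by apply: sym_power_span; apply: sub_lin_span; exists u. Qed.

End SymmetricTensors.

Section FockSpace.
Context {R : realType} {H : hilbertType R} {w : nat -> R} (F : fock_space H w).

Definition fock_pow n (x : H) : F := fock_in (vee (fock_power F n) (fun=> x)).

Lemma fock_in_vee_inner m n (u : 'I_m -> H) (v : 'I_n -> H) :
  m <> n ->
  inner (fock_in (vee (fock_power F m) u)) (fock_in (vee (fock_power F n) v)) = 0.
Proof. by move=> mn; apply: fock_in_orthogonal => //; exact: sym_power_vee. Qed.

Lemma fock_in0 n : fock_in (0 : fock_power F n) = 0.
Proof.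
have s0 : sym_power (fock_power F n) 0.
  by apply: sym_power_span; exact: (lin_span_subspace _).1.
have := fock_in_linear 1 s0 s0; rewrite !scale1r addr0 => /eqP.
by rewrite -subr_eq0 opprD addrA subrr sub0r oppr_eq0 => /eqP.
Qed.

Lemma fock_in_dist n (s t : fock_power F n) :
  sym_power _ s -> sym_power _ t ->
  nrm (fock_in s - fock_in t) ^+ 2 = w n ^+ 2 * nrm (s - t) ^+ 2.
Proof.
move=> ss st; rewrite !nrm_sqB -!Re_inner_nrm !fock_in_inner//.
rewrite !Re_realM; ring.
Qed.

(** Testing on the vectors [vee] extends by linearity to their span, then to its closure [sym_power]
    because [fock_in] scales distances by [w n], and finally to [F] by density. *)
Lemma fock_ext (y z : F) :
  (forall n (v : 'I_n -> H), inner y (fock_in (vee (fock_power F n) v)) =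
                   inner z (fock_in (vee (fock_power F n) v))) -> y = z.
Proof.
move=> h; apply: (dense_inner_ext (@fock_in_dense _ _ _ F)) => _ [n _ [s ss <-]].
apply/eqP; rewrite -subr_eq0 -innerBl -nrm_eq0 eq_le nrm_ge0 andbT.
have span t : lin_span (range (vee (fock_power F n))) t ->
    inner (y - z) (fock_in t) = 0.
  (* [fock_in] is known to be linear only on symmetric tensors, so membership in the span is carried
     along with the vanishing. *)
  pose B := lin_span (range (vee (fock_power F n))) `&`
    [set t | inner (y - z) (fock_in t) = 0].
  suff : lin_span (range (vee (fock_power F n))) `<=` B by move=> /[apply] -[].
  apply: lin_span_min => [|_ [v _ <-]]; last first.
    split; first by apply: sub_lin_span; exists v.
    by rewrite /= innerBl h subrr.
  split=> [|c a b [sa ha] [sb hb]].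
    by split; [exact: (lin_span_subspace _).1|rewrite /= fock_in0 inner0r].
  split; first exact: (lin_span_subspace _).2.
  rewrite /= fock_in_linear ?innerDr ?innerZr ?ha ?hb ?mulr0 ?addr0//;
  exact: sym_power_span.
apply/ler_addgt0Pr => e e0; rewrite add0r.
pose M := nrm (y - z) * `|w n| + 1.
have M0 : 0 < M by rewrite ltr_wpDl// mulr_ge0 ?nrm_ge0.
have [t spt st] := nrm_near ss (divr_gt0 e0 M0).
have {spt}[spt ht] := (sym_power_span spt, span _ spt).
have -> : inner (y - z) (fock_in s) = inner (y - z) (fock_in s - fock_in t).
  by rewrite [RHS]innerBr ht subr0.
apply: le_trans (cauchy_schwarz _ _) _.
have -> : nrm (fock_in s - fock_in t : F) = `|w n| * nrm (s - t).
  apply/eqP; rewrite -(@eqrXn2 _ 2%N) ?mulr_ge0 ?nrm_ge0//.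
  by rewrite fock_in_dist// exprMn real_normK ?num_real.
rewrite mulrA; apply: le_trans (_ : M * nrm (s - t) <= _).
  by rewrite ler_wpM2r ?nrm_ge0// lerDl.
by rewrite mulrC -ler_pdivlMr// ltW.
Qed.

End FockSpace.

Lemma fcat_l (T : Type) m n (u : 'I_m -> T) (v : 'I_n -> T) i :
  fcat u v (lshift n i) = u i.
Proof. by rewrite /fcat (unsplitK (inl _ i)). Qed.

Lemma fcat_r (T : Type) m n (u : 'I_m -> T) (v : 'I_n -> T) i :
  fcat u v (rshift m i) = v i.
Proof. by rewrite /fcat (unsplitK (inr _ i)). Qed.

Lemma fcat1 (T : Type) n (u x : T) (i : 'I_n.+1) :
  @fcat T 1 n (fun=> u) (fun=> x) i = if i == ord0 then u else x.
Proof.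
case: (@splitP 1 n i) => j ij.
  have -> : i = lshift n j by exact/val_inj.
  by rewrite fcat_l (ord1 j).
have -> : i = rshift 1 j by exact/val_inj.
by rewrite fcat_r.
Qed.

(** Such permutations are exactly those supported on the [n] remaining points. *)
Lemma card_perm_fix0 n : #|[pred s : 'S_n.+1 | s ord0 == ord0]| = n`!.
Proof.
have cn : #|[set~ (ord0 : 'I_n.+1)]%SET| = n by rewrite cardsC1 card_ord.
rewrite -[in RHS]cn -card_perm; apply: eq_card => s; rewrite !inE.
rewrite [RHS]unfold_in /perm_on; apply/eqP/fintype.subsetP => [s0 i|h]; last first.
  by apply/eqP; apply: contraTT isT => /(h _); rewrite !inE eqxx.
by rewrite !inE; apply: contraNN => /eqP ->; rewrite s0.
Qed.

(** * Creation and annihilation operators on symmetric powers of one vector *)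

Section FockOperators.
Context {R : realType} {d : nat} {X : manifold R d} {H : rkhs X}.
Context {L : ell2 R} {h : tensor_product L H} {w : nat -> R}.
Variable F : fock_space h w.
Hypothesis w_gt0 : forall n, 0 < w n.
Implicit Types (u x : h).
Local Notation creation := (@creation R d X H L h w F).
Local Notation annihilation := (@annihilation R d X H L h w F).

Lemma creation_bounded u : bounded_linear (creation u).
Proof.
split; first exact: fock_mul_linearr.
have [M hM] := @fock_mul_bounded _ _ _ F.
pose e : F := fock_in (vee (fock_power F 1) (fun=> u)).
exists (M * nrm e) => a; rewrite (le_trans (hM e a))//.
by rewrite (nrmE e) rmorphM.
Qed.

Lemma annihilation_bounded u : bounded_linear (annihilation u).
Proof. exact: adjoint_bounded (creation_bounded u). Qed.

Lemma creation_vee u n (v : 'I_n -> h) :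
  creation u (fock_in (vee (fock_power F n) v)) =
  fock_in (vee (fock_power F n.+1) (@fcat h 1 n (fun=> u) v)).
Proof. exact: fock_mul_vee. Qed.

Lemma fock_pow_inner m n x : nrm x = 1 ->
  inner (fock_pow F m x) (fock_pow F n x) = ((m == n)%:R * w n ^+ 2)%:C.
Proof.
move=> x1; rewrite /fock_pow; case: eqVneq => [->|/eqP mn]; last first.
  by rewrite fock_in_vee_inner// mul0r.
rewrite fock_in_inner; [|exact: sym_power_vee..].
by rewrite vee_const_inner big1 ?mulr1 ?mul1r// => i _; rewrite inner_nrm x1 expr1n.
Qed.

Lemma creation_pow_ortho u x m n : m <> n ->
  inner (creation u (fock_pow F m x)) (creation u (fock_pow F n x)) = 0.
Proof. by move=> mn; rewrite !creation_vee fock_in_vee_inner// => -[]. Qed.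

(** Both sides are tested against [vee v]: splitting off the slot of [u] leaves <x, u> times the
    inner product in degree [n]. The weight ratio arises since the adjoint refers to the weighted
    inner product; no factor [n.+1] appears, as [vee] averages over permutations. *)
Lemma annihilation_pow u x n :
  annihilation u (fock_pow F n.+1 x) =
  (((w n.+1 / w n) ^+ 2)%:C * inner u x) *: fock_pow F n x.
Proof.
apply: fock_ext => k v; rewrite -(adjointP (creation_bounded u)) creation_vee.
rewrite innerZl rmorphM /= -innerC /fock_pow.
have [kn|/eqP kn] := eqVneq k n; last first.
  by rewrite !fock_in_vee_inner ?mulr0// => [/esym|[/esym]].
subst k; rewrite !fock_in_inner; [|exact: sym_power_vee..].
rewrite !vee_const_inner (@big_split_ord _ _ _ 1 n) /= big_ord1.
under eq_bigr do rewrite fcat_r.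
have -> : (w n.+1 ^+ 2)%:C = ((w n.+1 / w n) ^+ 2)%:C * (w n ^+ 2)%:C :> R[i].
  by rewrite -rmorphM /= -exprMn divfK// lt0r_neq0.
rewrite fcat_l conj_realc; ring.
Qed.

(* In the permutation expansion of the inner product, the permutations fixing
   the slot of [u] contribute |u|^2 and all others |<u, x>|^2. *)
Lemma creation_pow_nrm u x n : nrm x = 1 ->
  nrm (creation u (fock_pow F n x)) ^+ 2 =
  w n.+1 ^+ 2 * (nrm (inner u x) ^+ 2 +
                 (nrm u ^+ 2 - nrm (inner u x) ^+ 2) / n.+1%:R).
Proof.
move=> x1; rewrite -Re_inner_nrm creation_vee.
rewrite fock_in_inner; [|exact: sym_power_vee..].
have xx : inner x x = 1 by rewrite inner_nrm x1 expr1n.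
have hs (s : 'S_n.+1) : \prod_i inner (@fcat h 1 n (fun=> u) (fun=> x) i)
      (@fcat h 1 n (fun=> u) (fun=> x) (s i)) =
    (nrm (inner u x) ^+ 2)%:C + (if s ord0 == ord0 then
    (nrm u ^+ 2)%:C - (nrm (inner u x) ^+ 2)%:C else 0).
  under eq_bigr do rewrite !fcat1.
  rewrite (bigD1 ord0)//=.
  have [s0|s0] := eqVneq (s ord0) ord0.
    rewrite addrC subrK big1 ?mulr1 ?inner_nrm// => i i0.
    by rewrite (negPf i0) -s0 (inj_eq perm_inj) (negPf i0).
  (* If [s] moves [ord0], just two factors differ from <x, x> = 1, those at [ord0] and at its
     preimage. They are <u, x> and its conjugate. *)
  rewrite (bigD1 (s^-1 ord0)%g)/=; last first.
    by apply: contra s0 => /eqP e; rewrite -{1}e permKV.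
  rewrite permKV eqxx ifN; last first.
    by apply: contra s0 => /eqP e; rewrite -{1}e permKV.
  rewrite big1 ?mulr1 ?addr0 => [|i /andP[i0 is0]].
    by rewrite (innerC u x) mulrC normc_sq.
  rewrite (negPf i0) ifN//; apply: contra is0 => /eqP <-.
  by rewrite permK.
rewrite vee_inner (eq_bigr _ (fun s _ => hs s)) big_split /= sumr_const card_Sn.
rewrite -big_mkcond /= sumr_const card_perm_fix0.
move: (nrm (inner u x) ^+ 2) (nrm u ^+ 2) => c a.
have ReE (b : R) (p q : nat) : complex.Re (b%:C *
    ((p%:R)^-1 * (c%:C *+ p + (a%:C - c%:C) *+ q))) =
    b * ((p%:R)^-1 * (c * p%:R + (a - c) * q%:R)).
  have -> : (p%:R : R[i])^-1 = (p%:R^-1)%:C by rewrite fmorphV rmorph_nat.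
  by rewrite !Re_realM raddfD /= !raddfMn raddfB !mulr_natr.
rewrite ReE factS natrM.
move: n`! (fact_gt0 n) => p p0; field.
by rewrite nat1r !pnatr_eq0 -!lt0n p0.
Qed.

Lemma creation_pow_le u x n : nrm x = 1 ->
  nrm (creation u (fock_pow F n x)) ^+ 2 <=
  w n.+1 ^+ 2 * (nrm (inner u x) ^+ 2 + nrm u ^+ 2 / n.+1%:R).
Proof.
move=> x1; rewrite creation_pow_nrm// ler_wpM2l ?sqr_ge0// lerD2l.
by rewrite ler_pM2r ?invr_gt0// gerBl sqr_ge0.
Qed.

End FockOperators.

Lemma pythagoras (R : realType) (H : hilbertType R) (f : nat -> H) (r : seq nat) :
  (forall i j, i <> j -> inner (f i) (f j) = 0) -> uniq r ->
  nrm (\sum_(i <- r) f i) ^+ 2 = \sum_(i <- r) nrm (f i) ^+ 2.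
Proof.
move=> orth; elim: r => [_|a r IH /= /andP[ar ur]].
  by rewrite !big_nil nrm0 expr0n.
rewrite !big_cons nrm_sqD IH// inner_sumr big1_seq ?mulr0 ?addr0//.
by move=> i /= ir; apply: orth => ai; move: ar; rewrite ai ir.
Qed.

Lemma cvg_bounded_linear (R : realType) (H : hilbertType R) (T : H -> H)
    (u : nat -> H) (l : H) :
  bounded_linear T -> u @ \oo --> l -> (fun n => T (u n)) @ \oo --> T l.
Proof.
move=> /bounded_linearP[lT [M M0 hM]] /cvg_nrmP ul; apply/cvg_nrmP => e e0.
have M1 : 0 < M + 1 by rewrite ltr_wpDl.
apply: filterS (ul _ (divr_gt0 e0 M1)) => n; rewrite ltr_pdivlMr// => h.
rewrite -(linB lT); apply: le_lt_trans (hM _) _; apply: le_lt_trans h.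
by rewrite mulrC ler_wpM2l ?nrm_ge0// lerDl.
Qed.

(** * Tails of coherent vectors as approximate joint eigenvectors *)

Section CoherentVectors.
Context {R : realType} {d : nat} {X : manifold R d} {H : rkhs X}.
Context {L : ell2 R} {h : tensor_product L H} {w : nat -> R}.
Variable F : fock_space h w.
Hypothesis w_gt0 : forall n, 0 < w n.
Hypothesis w_sum : exists M : R, forall N, \sum_(0 <= n < N) w n ^- 2 <= M.
Hypothesis w_ratio : forall e : R, 0 < e ->
  \forall n \near \oo, w n ^- 2 <= (1 + e) * w n.+1 ^- 2.
Local Notation creation := (@creation R d X H L h w F).
Local Notation annihilation := (@annihilation R d X H L h w F).

Definition coh (m : nat) (x : h) : F :=
  limn (fun N => \sum_(m <= n < N) ((w n ^- 2)%:C *: fock_pow F n x)).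

Let v n := w n ^- 2.
Let v_gt0 n : 0 < v n. Proof. by rewrite invr_gt0 exprn_gt0. Qed.
Let s N := \sum_(0 <= n < N) v n.

Let s_cvg : cvgn s.
Proof.
have [M hM] := w_sum; apply: nondecreasing_is_cvgn.
  apply/nondecreasing_seqP => n.
  by rewrite /s big_nat_recr//= lerDl ltW.
by exists M => _ [N _ <-]; exact: hM.
Qed.

Let s_cauchy (e : R) : 0 < e -> exists N, forall a b, (N <= a <= b)%N ->
  \sum_(a <= n < b) v n <= e.
Proof.
move=> e0; have /cvgrPdist_lt := s_cvg; have e2 : 0 < e / 2 by rewrite divr_gt0.
move=> /(_ _ e2)[N _ hN]; exists N => a b /andP[Na ab].
have := hN _ Na; have := hN _ (leq_trans Na ab) => /=.
rewrite /s (big_cat_nat _ ab)//= -/(s a).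
move: (lim _) (s a) (\sum_(_ <= _ < _) _) => l p q.
by rewrite !ltr_norml => /andP[h1 h2] /andP[h3 h4]; lra.
Qed.

(** The squared coefficient [w n ^- 4] meets the squared norm [w n ^+ 2] of the power, so squared
    norms of tails are tails of the same series of inverse squared weights. *)
Lemma psum_nrm x m N : nrm x = 1 ->
  nrm (\sum_(m <= n < N) ((w n ^- 2)%:C *: fock_pow F n x)) ^+ 2 =
  \sum_(m <= n < N) w n ^- 2.
Proof.
move=> x1; rewrite pythagoras ?iota_uniq//.
  apply: eq_bigr => n _; rewrite nrmZ exprMn nrm_real -Re_inner_nrm.
  rewrite fock_pow_inner// eqxx mul1r /= ger0_norm ?(ltW (v_gt0 n))//.
  by field; exact: lt0r_neq0.
move=> i j /eqP/negPf ij; rewrite innerZl innerZr fock_pow_inner// ij.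
by rewrite mul0r !mulr0.
Qed.

Lemma coh_cvg x m : nrm x = 1 ->
  (fun N => \sum_(m <= n < N) ((w n ^- 2)%:C *: fock_pow F n x)) @ \oo
    --> coh m x.
Proof.
move=> x1; suff [l hl] : exists l : F,
    (fun N => \sum_(m <= n < N) ((w n ^- 2)%:C *: fock_pow F n x)) @ \oo --> l.
  by rewrite /coh (cvg_lim _ hl)//; exact: norm_hausdorff.
apply: cauchy_nrm_cvg => e e0.
have [N hN] := s_cauchy (exprn_gt0 2 e0).
have key a b : (maxn N m <= a <= b)%N ->
    nrm (\sum_(m <= n < b) ((w n ^- 2)%:C *: fock_pow F n x) -
         \sum_(m <= n < a) ((w n ^- 2)%:C *: fock_pow F n x)) <= e.
  rewrite geq_max => /andP[/andP[Na ma] ab].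
  rewrite (big_cat_nat ma ab)/= addrAC subrr add0r.
  rewrite -ler_sqr ?nnegrE ?nrm_ge0 ?(ltW e0)// psum_nrm//.
  by apply: hN; rewrite Na.
exists (maxn N m) => a b Na Nb; case: (leqP a b) => ab.
  by rewrite nrmB; apply: key; rewrite Na.
by apply: key; rewrite Nb ltnW.
Qed.

Lemma coh_nrm_cvg x m : nrm x = 1 ->
  (fun N => \sum_(m <= n < N) w n ^- 2) @ \oo --> nrm (coh m x) ^+ 2.
Proof.
move=> x1; under eq_fun do rewrite -(psum_nrm _ _ x1) expr2.
by rewrite expr2; apply: cvgM; apply: cvg_nrm; exact: coh_cvg.
Qed.

Lemma coh_recl x m : nrm x = 1 ->
  coh m x = (w m ^- 2)%:C *: fock_pow F m x + coh m.+1 x.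
Proof.
move=> x1; rewrite {1}/coh; apply: cvg_lim; first exact: norm_hausdorff.
have hd : (fun N => (w m ^- 2)%:C *: fock_pow F m x +
      \sum_(m.+1 <= n < N) ((w n ^- 2)%:C *: fock_pow F n x)) @ \oo -->
    (w m ^- 2)%:C *: fock_pow F m x + coh m.+1 x.
  by apply: cvgD; [exact: cvg_cst|exact: coh_cvg].
apply: cvg_trans hd; apply: near_eq_cvg.
by exists m.+1 => // N /= mN; rewrite [RHS]big_ltn.
Qed.

(** The ratio in [annihilation_pow] turns the coefficient [w n.+1 ^- 2] into exactly [w n ^- 2];
    this is what dictates the coefficients of [Kvec]. *)
Lemma annihilation_coh u x m : nrm x = 1 ->
  annihilation u (coh m.+1 x) = inner u x *: coh m x.
Proof.
move=> x1.
have la := (annihilation_bounded F u).1.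
have h1 := cvg_bounded_linear (annihilation_bounded F u) (@coh_cvg x m.+1 x1).
have h2 : (fun N => inner u x *:
    \sum_(m <= n < N) ((w n ^- 2)%:C *: fock_pow F n x)) @ \oo -->
    inner u x *: coh m x by apply: cvgZr; exact: coh_cvg.
rewrite -(cvg_lim _ h2); last exact: norm_hausdorff.
apply/esym/cvg_lim; first exact: norm_hausdorff.
rewrite -(cvg_shiftS) in h1; apply: cvg_trans h1; apply: near_eq_cvg.
apply: nearW => N /=; rewrite big_add1 /= (lin_sum la) scaler_sumr.
apply: eq_bigr => n _; rewrite (linZ la) annihilation_pow// !scalerA.
congr (_ *: _); rewrite mulrA -rmorphM /= mulrC; congr (_ * _%:C).
by field; rewrite !lt0r_neq0.
Qed.

Lemma coh_inner_succ x m : nrm x = 1 ->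
  inner (coh m.+1 x) (coh m x) = (nrm (coh m.+1 x) ^+ 2)%:C.
Proof.
move=> x1; rewrite (coh_recl m x1) innerDr innerZr -inner_nrm.
suff -> : inner (coh m.+1 x) (fock_pow F m x) = 0 by rewrite mulr0 add0r.
rewrite innerC.
have hc := @cvg_innerr _ _ _ _ (fock_pow F m x) (@coh_cvg x m.+1 x1).
rewrite -(cvg_lim _ hc); last exact: norm_hausdorff.
have -> : (fun N => inner (fock_pow F m x)
  (\sum_(m.+1 <= n < N) (w n ^- 2)%:C *: fock_pow F n x) : R[i]^o) = fun=> 0.
  apply/funext => N; rewrite inner_sumr big_nat big1// => n /andP[mn _].
  by rewrite innerZr fock_pow_inner// (ltn_eqF mn) mul0r mulr0.
by rewrite lim_cst ?conjC0//; exact: norm_hausdorff.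
Qed.

Lemma psum_le_coh x m N : nrm x = 1 ->
  \sum_(m <= n < N) w n ^- 2 <= nrm (coh m x) ^+ 2.
Proof.
move=> x1; have cc := @coh_nrm_cvg x m x1.
apply: (cvgr_to_ge cc).
exists (maxn m N) => // k /=; rewrite geq_max => /andP[mk Nk].
case: (leqP m N) => mN; last first.
  rewrite big_geq ?sumr_ge0// ?(ltnW mN)// => n _; exact/ltW/v_gt0.
rewrite [leRHS](big_cat_nat mN Nk)//= lerDl sumr_ge0// => n _.
exact/ltW/v_gt0.
Qed.

Lemma coh_neq0 x m : nrm x = 1 -> coh m x != 0.
Proof.
move=> x1; rewrite -nrm_gt0.
have : 0 < nrm (coh m x) ^+ 2.
  apply: lt_le_trans (v_gt0 m) _.
  by have := psum_le_coh m m.+1 x1; rewrite big_nat1.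
by rewrite !lt_def sqrf_eq0 nrm_ge0 => /andP[->].
Qed.

(* Telescoping: the weights decrease slowly, hence no single term dominates. *)
Lemma weight_coh_le x (e : R) : nrm x = 1 -> 0 < e ->
  \forall m \near \oo, w m ^- 2 <= e * nrm (coh m.+1 x) ^+ 2.
Proof.
move=> x1 e0; have [N0 _ hN] := w_ratio e0; exists N0 => // m /= Nm.
have tel k : w m ^- 2 <= w (m + k) ^- 2 + e * \sum_(m.+1 <= n < (m + k).+1) w n ^- 2.
  elim: k => [|k IH]; first by rewrite addn0 big_geq// mulr0 addr0.
  apply: le_trans IH _; rewrite addnS [in leRHS]big_nat_recr ?ltnS ?leq_addr//=.
  have := hN (m + k)%N (leq_trans Nm (leq_addr _ _)).
  rewrite mulrDr; move: (\sum_(_ <= _ < _) _) (w (m + k) ^- 2) => S a.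
  move: (w _ ^- 2) => b; lra.
(* The leftover [w (m + N1) ^- 2] is a single term of the convergent series, at an index beyond
   [N1], hence at most [r]. *)
apply/ler_addgt0Pr => r r0; have [N1 hN1] := s_cauchy r0.
apply: le_trans (tel N1) _; rewrite addrC lerD//.
  by rewrite ler_wpM2l ?(ltW e0)// psum_le_coh.
have := hN1 (m + N1)%N (m + N1).+1; rewrite big_nat1; apply.
by rewrite leq_addl leqnSn.
Qed.

(** Distinct powers keep orthogonal images, so the comparison is made term by term. After division
    by v_n, the term is at most v_n / v_(n+1) times [C + nrm u ^+ 2 / n.+1%:R], and these factors
    tend to 1 and [C]. *)
Lemma creation_coh_le u x (e : R) : nrm x = 1 -> 0 < e ->
  \forall m \near \oo, nrm (creation u (coh m x)) ^+ 2 <=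
    (nrm (inner u x) ^+ 2 + e) * nrm (coh m x) ^+ 2.
Proof.
move=> x1 e0; set C := nrm (inner u x) ^+ 2.
have C0 : 0 <= C by exact: sqr_ge0.
have C1 : 0 < C + 1 by rewrite ltr_wpDl.
(* [e1] is the tolerance for the weight ratio and [e2] the one for [nrm u ^+ 2 / n.+1%:R]; they are
   tuned so that each uses at most half of [e] in the product. *)
pose e1 := e / (2 * (C + 1)); have e10 : 0 < e1 by rewrite divr_gt0// mulr_gt0.
pose e2 := e / (2 * (1 + e1)).
have e20 : 0 < e2 by rewrite divr_gt0// mulr_gt0// addr_gt0.
have Ce : (1 + e1) * (C + e2) <= C + e.
  have -> : (1 + e1) * (C + e2) = C + e1 * C + e / 2.
    by rewrite /e2; field; rewrite lt0r_neq0// addr_gt0.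
  have : e1 * C <= e / 2.
    rewrite /e1 (_ : _ * C = e / 2 * (C / (C + 1))); last first.
      by field; exact: lt0r_neq0.
    by rewrite ler_piMr ?divr_ge0 ?(ltW e0)// ler_pdivrMr// mul1r lerDl.
  lra.
have [N1 _ hN1] := w_ratio e10.
have [N2 hN2] : exists N2, forall n, (N2 <= n)%N -> nrm u ^+ 2 / n.+1%:R <= e2.
  have u1 : 0 < nrm u ^+ 2 + 1 by rewrite ltr_wpDl// sqr_ge0.
  have := @cvg_harmonic R; move/cvgrPdist_lt => /(_ _ (divr_gt0 e20 u1))[N2 _ hN2].
  exists N2 => n /hN2 /=; rewrite sub0r normrN ger0_norm ?invr_ge0//.
  rewrite ltr_pdivlMr// mulrC => hn; apply: le_trans (ltW hn).
  by rewrite ler_wpM2r ?invr_ge0// lerDl.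
exists (maxn N1 N2) => // m /=; rewrite geq_max => /andP[N1m N2m].
have bc := creation_bounded F u.
have cl := cvg_bounded_linear bc (@coh_cvg x m x1).
have cl2 : (fun N => nrm (creation u
    (\sum_(m <= n < N) ((w n ^- 2)%:C *: fock_pow F n x))) ^+ 2) @ \oo -->
    nrm (creation u (coh m x)) ^+ 2.
  by rewrite expr2; under eq_fun do rewrite expr2; apply: cvgM; exact: cvg_nrm.
have cr : (fun N => (C + e) * \sum_(m <= n < N) w n ^- 2) @ \oo -->
    (C + e) * nrm (coh m x) ^+ 2.
  by apply: cvgM; [exact: cvg_cst|exact: coh_nrm_cvg].
apply: (ler_cvg_to cl2 cr).
apply: nearW => N; rewrite (lin_sum bc.1) pythagoras ?iota_uniq//; last first.
  by move=> i j ij; rewrite !(linZ bc.1) innerZl innerZr creation_pow_ortho// !mulr0.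
rewrite mulr_sumr big_nat [leRHS]big_nat ler_sum// => n /andP[mn _].
rewrite (linZ bc.1) nrmZ exprMn nrm_real ger0_norm ?(ltW (v_gt0 n))//.
apply: le_trans
  (_ : (w n ^- 2) ^+ 2 * (w n.+1 ^+ 2 * (C + nrm u ^+ 2 / n.+1%:R)) <= _).
  by rewrite ler_wpM2l ?sqr_ge0// creation_pow_le.
apply: le_trans (_ : (1 + e1) * (C + e2) * w n ^- 2 <= _); last first.
  by rewrite ler_wpM2r// ltW// v_gt0.
have -> : (w n ^- 2) ^+ 2 * (w n.+1 ^+ 2 * (C + nrm u ^+ 2 / n.+1%:R)) =
   (w n ^- 2 * w n.+1 ^+ 2) * (C + nrm u ^+ 2 / n.+1%:R) * w n ^- 2.
  by rewrite expr2; ring.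
rewrite ler_wpM2r ?(ltW (v_gt0 n))//.
have hw : w n ^- 2 * w n.+1 ^+ 2 <= 1 + e1.
  rewrite -ler_pdivlMr ?exprn_gt0//; exact: hN1 (leq_trans N1m mn).
apply: ler_pM => //.
- by rewrite mulr_ge0 ?sqr_ge0// ltW// v_gt0.
- by rewrite addr_ge0// divr_ge0// sqr_ge0.
- by rewrite lerD2l; exact: hN2 (leq_trans N2m mn).
Qed.

Lemma approx_eig_annihilation u x : nrm x = 1 ->
  approx_eig (coh^~ x) (annihilation u) (inner u x).
Proof.
move=> x1 e e0; have C1 : 0 < nrm (inner u x) ^+ 2 + 1.
  by rewrite ltr_wpDl// sqr_ge0.
have [N _ hN] := weight_coh_le x1 (divr_gt0 (exprn_gt0 2 e0) C1).
(* Starting at [N.+1] excludes index 0, so that the vector is a [coh m.+1 x] and [annihilation_coh]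
   applies. *)
exists N.+1 => // -[//|m] /= Nm; have {hN} := hN m Nm.
rewrite annihilation_coh// -scalerBr (coh_recl m x1) addrK !nrmZ => hm.
rewrite -ler_sqr ?nnegrE ?mulr_ge0 ?nrm_ge0 ?(ltW e0)// !exprMn.
rewrite -[nrm (fock_pow _ _ _) ^+ 2]Re_inner_nrm fock_pow_inner// eqxx mul1r /=.
rewrite nrm_real real_normK ?num_real//.
have -> : (w m ^- 2) ^+ 2 * w m ^+ 2 = w m ^- 2 by field; exact: lt0r_neq0.
move: hm; rewrite mulrAC ler_pdivlMr// mulrDr mulr1; apply: le_trans.
by rewrite mulrC lerDl ltW// v_gt0.
Qed.

Lemma approx_eig_creation u x : nrm x = 1 ->
  approx_eig (coh^~ x) (creation u) (inner u x)^*.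
Proof.
move=> x1 e e0.
have [N _ hN] := creation_coh_le u x1 (exprn_gt0 2 e0).
exists N.+1 => // -[//|m] /= Nm; have {hN} := hN m.+1 (leqW Nm).
set K := coh m.+1 x; set c := inner u x; move=> hm.
rewrite -ler_sqr ?nnegrE ?mulr_ge0 ?nrm_ge0 ?(ltW e0)// exprMn.
rewrite nrm_sqB nrmZ nrmJ exprMn innerZr.
(* The cross term is exact: moving [creation u] across lowers the index by one, and [coh m x]
   differs from [K] only by a vector orthogonal to [K]. *)
have -> : inner (creation u K) K = c * (nrm K ^+ 2)%:C.
  rewrite innerC -/(creation u) (adjointP (creation_bounded F u)).
  rewrite -[adjoint _]/(annihilation u) annihilation_coh// innerZl.
  rewrite rmorphM /= conjCK -innerC; congr (_ * _).
  exact: coh_inner_succ.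
rewrite mulrA normc_sq -rmorphM /=; move: hm; rewrite mulrDl; lra.
Qed.

Lemma annihilation_eig u x : nrm x = 1 ->
  eig_algebra (coh^~ x) (annihilation u).
Proof.
move=> x1; split; first exact: annihilation_bounded.
exists (inner u x); split; first exact: approx_eig_annihilation.
rewrite /Defs.annihilation adjointK; last exact: creation_bounded.
exact: approx_eig_creation.
Qed.

End CoherentVectors.

(** * The weights exp (tau n^p): summability and slow growth *)

Section Weights.
Context {R : realType} (tau p : R).
Hypotheses (tau_gt0 : 0 < tau) (p_gt0 : 0 < p) (p_lt1 : p < 1).
Local Notation w := (weight tau p).

Lemma weight_gt0 n : 0 < w n.
Proof. exact: expR_gt0. Qed.

Lemma weight_invsq n : w n ^- 2 = expR (- (2 * tau * n%:R `^ p)).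
Proof. by rewrite expRN /weight -expRM_natl; congr (expR _)^-1; ring. Qed.

(** Factor out n^p and use (1 + 1/n)^p <= 1 + 1/n, valid for p <= 1. The increment of n^p therefore
    tends to 0 as p < 1. *)
Lemma powR_succ_le n : (0 < n)%N ->
  n.+1%:R `^ p <= n%:R `^ p + (n%:R `^ (1 - p))^-1 :> R.
Proof.
move=> n0; have n0' : 0 < n%:R :> R by rewrite ltr0n.
have -> : n.+1%:R = n%:R * (1 + n%:R^-1) :> R.
  by rewrite mulrDr mulr1 divff ?lt0r_neq0// -natr1.
rewrite powRM ?ler0n ?addr_ge0 ?invr_ge0//.
have -> : (n%:R `^ (1 - p))^-1 = n%:R `^ p / n%:R :> R.
  rewrite -powRN opprB powRD; last by rewrite lt0r_neq0// implybT.
  by rewrite -(powR_inv1 (ltW n0')).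
rewrite -[X in _ <= X + _]mulr1 -mulrDr ler_wpM2l ?powR_ge0//.
rewrite -[leRHS]powRr1 ?addr_ge0 ?invr_ge0//.
by rewrite ler_powR ?lerDl ?invr_ge0// ltW.
Qed.

Lemma weight_ratio (e : R) : 0 < e ->
  \forall n \near \oo, w n ^- 2 <= (1 + e) * w n.+1 ^- 2.
Proof.
move=> e0; have e1 : 0 < 1 + e by rewrite addr_gt0.
have l0 : 0 < ln (1 + e) by rewrite ln_gt0// ltrDl.
have q0 : 0 < 1 - p by rewrite subr_gt0.
(* Once n^(1-p) exceeds [A], the exponent 2 tau n^p grows by at most ln (1 + e) in one step. *)
pose A := 2 * tau / ln (1 + e).
have A0 : 0 < A by rewrite divr_gt0// mulr_gt0.
exists (Num.truncn (A `^ (1 - p)^-1)).+1 => // n /= Nn.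
have n0 : (0 < n)%N by exact: leq_trans Nn.
have nA : A <= n%:R `^ (1 - p).
  have <- : (A `^ (1 - p)^-1) `^ (1 - p) = A.
    by rewrite -powRrM mulVf ?lt0r_neq0// powRr1// ltW.
  apply: (ge0_ler_powR (ltW q0)); rewrite ?nnegrE ?powR_ge0 ?ler0n//.
  by apply/ltW/(lt_le_trans (truncnS_gt _)); rewrite ler_nat.
have -> : (1 + e) * w n.+1 ^- 2 = expR (ln (1 + e) - 2 * tau * n.+1%:R `^ p).
  by rewrite expRD lnK// weight_invsq.
rewrite weight_invsq ler_expR.
have := powR_succ_le n0.
have : 2 * tau * (n%:R `^ (1 - p))^-1 <= ln (1 + e).
  by rewrite ler_pdivrMr ?(lt_le_trans A0 nA)// -ler_pdivrMl// mulrC.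
move: (n%:R `^ (1 - p))^-1 (n%:R `^ p) (n.+1%:R `^ p) (ln _) => a b c l h1 h2.
have : 2 * tau * c <= 2 * tau * (b + a) by rewrite ler_wpM2l// ltW// mulr_gt0.
rewrite mulrDr; lra.
Qed.

Lemma weight_sum : exists M : R, forall N, \sum_(0 <= n < N) w n ^- 2 <= M.
Proof.
have [k k0 kp] : exists2 k, (0 < k)%N & 2 <= p * k%:R.
  exists (Num.truncn (2 / p)).+1 => //; rewrite mulrC -ler_pdivrMr//.
  exact/ltW/truncnS_gt.
(* w n ^- 2 <= C / n ^ 2, from (y / k) ^ k <= exp y with y = 2 tau n ^ p *)
pose C := (k%:R / (2 * tau)) ^+ k.
have t2 : 0 < 2 * tau by rewrite mulr_gt0.
have k0' : 0 < k%:R :> R by rewrite ltr0n.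
have C0 : 0 <= C by rewrite exprn_ge0// divr_ge0// ltW.
have term n : (0 < n)%N -> w n ^- 2 <= C / n%:R ^+ 2.
  move=> n0; have n1 : 1 <= n%:R :> R by rewrite ler1n.
  have n0' : 0 < n%:R :> R by rewrite ltr0n.
  have y0 : 0 < 2 * tau * n%:R `^ p by rewrite mulr_gt0// powR_gt0.
  rewrite weight_invsq expRN -[C / _]invrK lef_pV2 ?posrE ?expR_gt0//; last first.
    by rewrite invr_gt0 divr_gt0 ?exprn_gt0 ?divr_gt0.
  have -> : 2 * tau * n%:R `^ p = k%:R * (2 * tau * n%:R `^ p / k%:R).
    by rewrite [RHS]mulrC divfK// lt0r_neq0.
  rewrite expRM_natl.
  apply: le_trans (_ : (2 * tau * n%:R `^ p / k%:R) ^+ k <= _); last first.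
    rewrite ler_pXn2r ?nnegrE ?expR_ge0 ?divr_ge0 ?(ltW y0)//.
    by apply: le_trans (expR_ge1Dx _); rewrite lerDr.
  rewrite invf_div mulrC mulrAC exprMn -(invf_div k%:R) exprVn -/C.
  rewrite ler_wpM2l ?invr_ge0//.
  rewrite -(powR_mulrn k) ?powR_ge0// -powRrM -(powR_mulrn 2) ?ler0n//.
  by rewrite ler_powR.
exists (1 + 2 * C) => N.
(* The leading 1 is the term n = 0. The rest telescopes by 1/a^2 <= 2 (1/a - 1/(a+1)) for a >= 1,
   which is where the factor 2 comes from. *)
have claim : \sum_(0 <= n < N.+1) w n ^- 2 <= 1 + 2 * C * (1 - N.+1%:R^-1).
  elim: N => [|N IH].
    rewrite big_nat1 weight_invsq powR0 ?lt0r_neq0// mulr0 oppr0 expR0.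
    by rewrite invr1 subrr mulr0 addr0.
  rewrite big_nat_recr//=; apply: le_trans (lerD IH (term N.+1 _)) _ => //.
  have h1 : 1 <= N.+1%:R :> R by rewrite ler1n.
  rewrite -(natr1 N.+1); move: (N.+1%:R) h1 => a a1.
  have a0 : 0 < a by exact: lt_le_trans a1.
  have : C * (2 / (a * (a + 1)) - a ^- 2) >= 0.
    rewrite mulr_ge0// (_ : _ - _ = (a - 1) / (a ^+ 2 * (a + 1))); last first.
      by field; rewrite !lt0r_neq0// addr_gt0.
    by rewrite divr_ge0 ?subr_ge0// mulr_ge0 ?sqr_ge0// addr_ge0// ltW.
  have -> : 1 + 2 * C * (1 - (a + 1)^-1) = 1 + 2 * C * (1 - a^-1) + C / a ^+ 2 +
      C * (2 / (a * (a + 1)) - a ^- 2).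
    by field; rewrite !lt0r_neq0// addr_gt0.
  by rewrite lerDl.
apply: le_trans (_ : \sum_(0 <= n < N.+1) w n ^- 2 <= _).
  by rewrite big_nat_recr//= lerDl invr_ge0 exprn_ge0// ltW// weight_gt0.
apply: le_trans claim _; rewrite lerD2l ler_piMr ?mulr_ge0//.
Qed.

End Weights.

(** * Smooth functions form an algebra stable under conjugation *)

Section SmoothFunctions.
Context {R : realType} {d : nat}.
Implicit Types (U : set 'rV[R]_d) (f g : 'rV[R]_d -> R).

(** Derivatives in [Ck] are taken of functions on the whole space, while the rules for sums and
    products hold only on [U]. Openness makes agreement on [U] local, so it passes to
    derivatives. *)
Lemma Ck_eq k U f g : open U -> (forall y, U y -> f y = g y) ->
  Ck k U f -> Ck k U g.
Proof.
move=> oU.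
have near_fg f' g' y : (forall y, U y -> f' y = g' y) -> U y ->
    \forall z \near y, f' z = g' z.
  by move=> fg Uy; apply: filterS fg _; exact: open_nbhs_nbhs.
have cts_fg f' g' : (forall y, U y -> f' y = g' y) ->
    (forall y, U y -> {for y, continuous f'}) ->
    forall y, U y -> {for y, continuous g'}.
  move=> fg cf y Uy; rewrite /prop_for /continuous_at -fg//.
  by apply: cvg_trans (near_eq_cvg (near_fg _ _ _ _ Uy)) (cf y Uy) => z /fg.
elim: k f g => [|k IH] f g fg [cf df]; split=> //; try exact: cts_fg fg cf.
move=> j; have [dj Cj] := df j; split.
  by move=> y Uy; apply: near_eq_derivable (dj y Uy); exact: near_fg.
by apply: IH Cj => y Uy; apply: near_eq_derive; exact: near_fg.
Qed.

Lemma CkS k U f : Ck k.+1 U f -> Ck k U f.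
Proof.
elim: k f => [|k IH] f [cf df]; first by split.
by split=> // j; have [dj Cj] := df j; split=> //; exact: IH.
Qed.

Lemma Ck_cst k U (c : R) : Ck k U (cst c).
Proof.
elim: k c => [|k IH] c; split=> //; try by move=> y _; exact: cst_continuous.
move=> j; split=> [y _|]; first exact: derivable_cst.
by rewrite (_ : (fun y => _) = cst 0)//; apply/funext => y; exact: derive_cst.
Qed.

Lemma CkD k U f g : open U -> Ck k U f -> Ck k U g -> Ck k U (f + g).
Proof.
move=> oU; elim: k f g => [|k IH] f g [cf df] [cg dg].
  by split=> // y Uy; apply: continuousD; [exact: cf|exact: cg].
split; first by move=> y Uy; apply: continuousD; [exact: cf|exact: cg].
move=> j; have [dfj Cfj] := df j; have [dgj Cgj] := dg j; split.
  by move=> y Uy; apply: derivableD; [exact: dfj|exact: dgj].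
apply: (Ck_eq oU _ (IH _ _ Cfj Cgj)) => y Uy.
by rewrite deriveD//; [exact: dfj|exact: dgj].
Qed.

Lemma CkM k U f g : open U -> Ck k U f -> Ck k U g -> Ck k U (f * g).
Proof.
move=> oU; elim: k f g => [|k IH] f g.
  move=> [cf _] [cg _]; split=> // y Uy.
  by apply: continuousM; [exact: cf|exact: cg].
move=> Cf Cg; have [cf df] := Cf; have [cg dg] := Cg; split.
  by move=> y Uy; apply: continuousM; [exact: cf|exact: cg].
move=> j; have [dfj Cfj] := df j; have [dgj Cgj] := dg j; split.
  by move=> y Uy; apply: derivableM; [exact: dfj|exact: dgj].
apply: (Ck_eq oU _ (CkD oU (IH _ _ (CkS Cf) Cgj) (IH _ _ (CkS Cg) Cfj))) => y Uy.
by rewrite deriveM//; [exact: dfj|exact: dgj].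
Qed.

Context {X : manifold R d}.
Implicit Types (a b : X -> R) (u v : X -> R[i]).

Lemma smoothR_cst (c : R) : smoothR (cst c : X -> R).
Proof. by move=> i k; exact: Ck_cst. Qed.

Lemma smoothRD a b : smoothR a -> smoothR b -> smoothR (a + b).
Proof.
move=> ha hb i k.
exact: (CkD (@chart_cod_open _ _ X i) (ha i k) (hb i k)).
Qed.

Lemma smoothRM a b : smoothR a -> smoothR b -> smoothR (a * b).
Proof.
move=> ha hb i k.
exact: (CkM (@chart_cod_open _ _ X i) (ha i k) (hb i k)).
Qed.

Lemma smoothRN a : smoothR a -> smoothR (- a).
Proof.
move=> ha; rewrite -mulN1r; apply: smoothRM => //.
exact: (smoothR_cst (-1)).
Qed.

Lemma smoothR_continuous a : smoothR a -> continuous a.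
Proof.
move=> ha x; set i := chart_at x.
have ix : chart_dom i x by exact: chart_at_dom.
have [cf _] := ha i 0%N.
have cx : {for x, continuous ((a \o chart_inv i) \o chart i)}.
  apply: continuous_comp; first exact: chart_continuous.
  by apply: cf; exists x.
rewrite /continuous_at -[a x in X in _ --> X](congr1 a (chartK ix)).
apply: cvg_trans cx; apply: near_eq_cvg.
have : \forall z \near x, chart_dom i z.
  by apply: open_nbhs_nbhs; split=> //; exact: chart_dom_open.
by apply: filterS => z iz /=; rewrite chartK.
Qed.

Lemma smoothC_continuous u : smoothC u -> continuous (u : X -> R[i]^o).
Proof.
move=> [/smoothR_continuous cr /smoothR_continuous ci] x.
apply/cvgrPdist_lt => e /lt0c_real[r r0 ->].
have r2 : 0 < r / 2 by rewrite divr_gt0.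
have /cvgrPdist_lt/(_ _ r2) hr := cr x.
have /cvgrPdist_lt/(_ _ r2) hi := ci x.
apply: filterS2 hr hi => y hr hi; rewrite nrmE ltcR.
apply: le_lt_trans (nrm_le_ReIm _) _; rewrite !raddfB /=; lra.
Qed.

Lemma smoothC_cst (c : R[i]) : smoothC (cst c : X -> R[i]).
Proof. by split; exact: smoothR_cst. Qed.

Lemma smoothCD u v : smoothC u -> smoothC v -> smoothC (u + v).
Proof.
move=> [ur ui] [vr vi]; split.
  rewrite (_ : (fun x => _) = (fun x => complex.Re (u x)) +
    (fun x => complex.Re (v x))); first exact: smoothRD.
  by apply/funext => x; rewrite !fctE raddfD.
rewrite (_ : (fun x => _) = (fun x => complex.Im (u x)) +
  (fun x => complex.Im (v x))); first exact: smoothRD.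
by apply/funext => x; rewrite !fctE raddfD.
Qed.

Lemma smoothCM u v : smoothC u -> smoothC v -> smoothC (u * v).
Proof.
move=> [ur ui] [vr vi]; split.
  rewrite (_ : (fun x => _) =
      (fun x => complex.Re (u x)) * (fun x => complex.Re (v x)) -
      (fun x => complex.Im (u x)) * (fun x => complex.Im (v x))).
    by apply: smoothRD; [|apply: smoothRN]; exact: smoothRM.
  by apply/funext => x; rewrite !fctE; case: (u x) (v x) => p q [r s].
rewrite (_ : (fun x => _) =
    (fun x => complex.Re (u x)) * (fun x => complex.Im (v x)) +
    (fun x => complex.Im (u x)) * (fun x => complex.Re (v x))).
  by apply: smoothRD; exact: smoothRM.
by apply/funext => x; rewrite !fctE; case: (u x) (v x) => p q [r s].
Qed.

Lemma smoothCJ u : smoothC u -> smoothC (fun x => (u x)^*).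
Proof.
move=> [ur ui]; split.
  rewrite (_ : (fun x => _) = fun x => complex.Re (u x))//.
  by apply/funext => x; case: (u x).
rewrite (_ : (fun x => _) = - (fun x => complex.Im (u x))); first exact: smoothRN.
by apply/funext => x; rewrite !fctE; case: (u x).
Qed.

End SmoothFunctions.

Section Ell2Basis.
Context {R : realType} (L : ell2 R).

(** The indicator sequence is square-summable, which rules out the default 0 of [xget]. *)
Lemma coord_e1 : Defs.coord (ell2_e1 L) = fun n => (n == 0)%:R.
Proof.
rewrite /ell2_e1; case: xgetP => [u _ //|] /=.
suff [u hu] : exists u : L, Defs.coord u = fun n => (n == 0)%:R by move=> /(_ u).
apply/coord_range/cvg_ex; exists (1 : R[i]^o); apply: cvg_near_cst.
exists 1%N => // n /= n1; rewrite /series /= big_ltn// big_nat big1 ?addr0.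
  by rewrite normr1 expr1n.
by move=> i /andP[i1 _]; rewrite -[i == 0]negbK -lt0n i1 normr0 expr0n.
Qed.

Lemma nrm_e1 : nrm (ell2_e1 L) = 1.
Proof.
suff e1 : inner (ell2_e1 L) (ell2_e1 L) = 1.
  apply/eqP; rewrite -(@eqrXn2 _ 2%N) ?nrm_ge0// expr1n -Re_inner_nrm.
  by rewrite e1.
have h1 := @coord_inner _ L (ell2_e1 L) (ell2_e1 L).
apply: (cvg_unique (@norm_hausdorff _ (R[i]^o)) h1).
apply: cvg_near_cst; exists 1%N => // n /= n1.
rewrite /series /= coord_e1 big_ltn// big_nat big1 ?addr0.
  by rewrite mulr1 conjC1.
by move=> i /andP[i1 _]; rewrite -[i == 0]negbK -lt0n i1 mulr0.
Qed.

Lemma finsupp_e1 : finsupp_seq (ell2_e1 L).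
Proof. by exists 1%N => -[|n] // _; rewrite coord_e1. Qed.

End Ell2Basis.

(** * The limit states as characters, and regularity in the point *)

Section AsymptoticCharacters.
Context {R : realType} {d : nat} {X : manifold R d} {H : rkhs X}.
Hypothesis unit_sections : forall x : X, `|ksec H x| = 1.
Context {L : ell2 R} {h : tensor_product L H} {w : nat -> R}.
Variable F : fock_space h w.
Hypothesis w_gt0 : forall n, 0 < w n.
Hypothesis w_sum : exists M : R, forall N, \sum_(0 <= n < N) w n ^- 2 <= M.
Hypothesis w_ratio : forall e : R, 0 < e ->
  \forall n \near \oo, w n ^- 2 <= (1 + e) * w n.+1 ^- 2.
Variable Hoo : set H.
Local Notation annihilation := (@annihilation R d X H L h w F).
Implicit Types (x : X) (a b : F -> F).

Definition one_particle x : h := tensor h (ell2_e1 L) (ksec H x).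

Lemma nrm_one_particle x : nrm (one_particle x) = 1.
Proof.
apply/eqP; rewrite -(@eqrXn2 _ 2%N) ?nrm_ge0// expr1n -Re_inner_nrm.
rewrite tensor_inner !inner_nrm nrm_e1 expr1n mul1r /=.
by rewrite /nrm unit_sections expr1n.
Qed.

Lemma Kvec_coh m x : Kvec F m x = coh F m (one_particle x).
Proof. by []. Qed.

Lemma Kvec_neq0 x m : Kvec F m x != 0.
Proof. by rewrite Kvec_coh coh_neq0// nrm_one_particle. Qed.

Definition eig_at x : set (F -> F) := eig_algebra (fun m => Kvec F m x).

Lemma eig_at_star x : star_subalgebra (eig_at x).
Proof. exact: eig_algebra_star. Qed.

Lemma phi_cvg x a c : approx_eig (fun m => Kvec F m x) a c ->
  (fun m => phi F m x a : R[i]^o) @ \oo --> (c : R[i]^o).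
Proof. by apply: approx_eig_inner => m; exact: Kvec_neq0. Qed.

(** Reduces every algebraic property of [Psi] to one of approximate eigenvalues, existence of the
    limit included. *)
Lemma Psi_eig x a c : approx_eig (fun m => Kvec F m x) a c -> Psi F x a = c.
Proof. by move=> /phi_cvg/cvg_lim; apply; exact: norm_hausdorff. Qed.

Lemma eig_atP x a : eig_at x a ->
  [/\ bounded_linear a, approx_eig (fun m => Kvec F m x) a (Psi F x a)
    & approx_eig (fun m => Kvec F m x) (adjoint a) (Psi F x a)^*].
Proof. by move=> [ba [c [ac ac']]]; rewrite (Psi_eig ac). Qed.

Lemma Psi_id x : Psi F x id = 1.
Proof. exact/Psi_eig/approx_eig_id. Qed.

Lemma Psi_lc x c a b : eig_at x a -> eig_at x b ->
  Psi F x (c *: a + b) = c * Psi F x a + Psi F x b.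
Proof.
move=> /eig_atP[_ ha _] /eig_atP[_ hb _]; apply: Psi_eig.
exact: approx_eig_lc.
Qed.

Lemma Psi_comp x a b : eig_at x a -> eig_at x b ->
  Psi F x (a \o b) = Psi F x a * Psi F x b.
Proof.
move=> /eig_atP[ba ha _] /eig_atP[_ hb _]; apply: Psi_eig.
exact: approx_eig_comp.
Qed.

Lemma Psi_adjoint x a : eig_at x a -> Psi F x (adjoint a) = (Psi F x a)^*.
Proof. by move=> /eig_atP[_ _]; exact: Psi_eig. Qed.

Lemma Psi_bound x a M : (forall u, nrm (a u) <= M * nrm u) -> eig_at x a ->
  nrm (Psi F x a) <= M.
Proof.
move=> hM /eig_atP[_ ha _]; apply: approx_eig_bound hM ha => m.
exact: Kvec_neq0.
Qed.

Lemma Psi_annihilation x u :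
  Psi F x (annihilation u) = inner u (one_particle x).
Proof.
apply: Psi_eig; apply: approx_eig_annihilation => //.
exact: nrm_one_particle.
Qed.

Lemma eig_at_annihilation x u : eig_at x (annihilation u).
Proof. by apply: annihilation_eig => //; exact: nrm_one_particle. Qed.

(** Propagates a regularity property from generators to the algebra they generate; [Q] will be
    smoothness for [A_oo] and continuity for [A_cstar]. *)
Lemma star_subalgebra_Psi_hat (Q : set (X -> R[i])) :
  Q 0 -> (forall c f g, Q f -> Q g -> Q (c *: f + g)) ->
  (forall f g, Q f -> Q g -> Q (f * g)) ->
  (forall f, Q f -> Q (fun x => (f x)^*)) ->
  star_subalgebra [set a : F -> F |
    [/\ bounded_linear a, forall x, eig_at x a & Q (Psi_hat F a)]].
Proof.
move=> Q0 QD QM QJ; split.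
- by move=> a [].
- split.
    split; first exact: bounded_linear0.
      by move=> x; have [_ [h1 _] _ _] := eig_at_star x.
    rewrite (_ : Psi_hat F 0 = 0)//; apply/funext => x.
    exact/Psi_eig/approx_eig0.
  move=> c a b [ba ea Qa] [bb eb Qb]; split; first exact: bounded_linear_lc.
    by move=> x; have [_ [_ h2] _ _] := eig_at_star x; apply: h2.
  rewrite (_ : Psi_hat F _ = c *: Psi_hat F a + Psi_hat F b); first exact: QD.
  by apply/funext => x; exact: Psi_lc.
- move=> a b [ba ea Qa] [bb eb Qb]; split; first exact: bounded_linear_comp.
    by move=> x; have [_ _ h3 _] := eig_at_star x; apply: h3.
  rewrite (_ : Psi_hat F _ = Psi_hat F a * Psi_hat F b); first exact: QM.
  by apply/funext => x; exact: Psi_comp.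
- move=> a [ba ea Qa]; split; first exact: adjoint_bounded.
    by move=> x; have [_ _ _ h4] := eig_at_star x; apply: h4.
  rewrite (_ : Psi_hat F _ = fun x => (Psi_hat F a x)^*); first exact: QJ.
  by apply/funext => x; exact: Psi_adjoint.
Qed.

(** For u = c (x) f the function is a constant times the conjugate of f, smooth since [H] consists
    of smooth functions. Only finite combinations occur, [h0] being an algebraic tensor product. *)
Lemma smooth_inner_one_particle u : h0 Hoo u ->
  smoothC (fun x => inner u (one_particle x)).
Proof.
move: u; apply: (@lin_span_min _ _ _
  [set u | smoothC (fun x => inner u (one_particle x))]).
  split=> [|c v v' sv sv'] /=.
    rewrite (_ : (fun x => _) = cst 0); first exact: smoothC_cst.
    by apply/funext => x; rewrite inner0l.
  rewrite (_ : (fun x => _) = cst c^* * (fun x => inner v (one_particle x)) +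
    (fun x => inner v' (one_particle x))).
    by apply: smoothCD => //; apply: smoothCM => //; exact: smoothC_cst.
  by apply/funext => x; rewrite innerDl innerZl.
move=> _ [c [f [_ _ ->]]] /=.
rewrite (_ : (fun x => _) = cst (inner c (ell2_e1 L)) * (fun x => (fun_of f x)^*)).
  apply: smoothCM; first exact: smoothC_cst.
  by apply: smoothCJ; exact: fun_of_smooth.
by apply/funext => x; rewrite tensor_inner !fctE reproducing -innerC.
Qed.

Lemma A_oo_smooth a : A_oo F Hoo a ->
  [/\ bounded_linear a, forall x, eig_at x a & smoothC (Psi_hat F a)].
Proof.
move: a; apply: smallest_sub.
  apply: (star_subalgebra_Psi_hat (smoothC_cst 0)) => [c f g sf sg|f g|f].
  - rewrite (_ : c *: f = cst c * f)//.
    by apply: smoothCD => //; apply: smoothCM => //; exact: smoothC_cst.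
  - exact: smoothCM.
  - exact: smoothCJ.
move=> _ [->|[u hu <-]]; split.
- exact: bounded_linear_id.
- by move=> x; exact: eig_algebra_id.
- rewrite (_ : Psi_hat F id = cst 1); first exact: smoothC_cst.
  by apply/funext => x; exact: Psi_id.
- exact: annihilation_bounded.
- by move=> x; exact: eig_at_annihilation.
- rewrite (_ : Psi_hat F _ = fun x => inner u (one_particle x)).
    exact: smooth_inner_one_particle.
  by apply/funext => x; exact: Psi_annihilation.
Qed.

(** The bound [Psi_bound] is uniform in the point, so norm limits of operators become uniform limits
    of functions. Those preserve continuity but not smoothness, hence the target [Cb]. *)
Lemma A_cstar_continuous a : A_cstar F Hoo a ->
  [/\ bounded_linear a, forall x, eig_at x a
    & continuous (Psi_hat F a : X -> R[i]^o)].
Proof.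
move: a; apply: smallest_sub; last first.
  by move=> a /A_oo_smooth[ba ea sa]; split=> //; exact: smoothC_continuous.
split.
  apply: (@star_subalgebra_Psi_hat [set f | continuous (f : X -> R[i]^o)]).
  - by move=> x; exact: cvg_cst.
  - move=> c f g cf cg x.
    apply: (@cvgD _ (R[i]^o)); last exact: cg.
    by apply: (@cvgM (R[i])); [exact: cvg_cst|exact: cf].
  - by move=> f g cf cg x; apply: (@cvgM (R[i])); [exact: cf|exact: cg].
  - move=> f cf x; apply/cvgrPdist_lt => e e0.
    have /cvgrPdist_lt/(_ _ e0) := cf x; apply: filterS => y.
    by rewrite !nrmE -rmorphB nrmJ.
move=> a ba hcl; have ea x : eig_at x a.
  apply: eig_algebra_closed => // [m|e /hcl[b [_ eb _] hb]]; first exact: Kvec_neq0.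
  by exists b; [exact: eb|exact: hb].
split=> // x; apply/cvgrPdist_lt => _ /lt0c_real[e e0 ->].
have e3 : 0 < e / 3 by rewrite divr_gt0.
have [b [bb eb cb] hb] := hcl _ e3.
have close y : nrm (Psi F y a - Psi F y b) <= e / 3.
  have -> : Psi F y a - Psi F y b = Psi F y (-1 *: b + a).
    by rewrite Psi_lc// mulN1r addrC.
  apply: Psi_bound => [u|]; first by rewrite !fctE scaleN1r addrC -nrm_leP.
  by have [_ [_ h2] _ _] := eig_at_star y; apply: h2.
have e3' : (0 : R[i]) < (e / 3)%:C by rewrite ltcR.
have /cvgrPdist_lt/(_ _ e3') := cb x; apply: filterS => y.
rewrite !nrmE !ltcR /Psi_hat => hxy.
have -> : e = e / 3 + (e / 3 + e / 3) by field.
apply: le_lt_trans (nrm_tri (Psi F x b) _ _) _; apply: ler_ltD; first exact: close.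
apply: le_lt_trans (nrm_tri (Psi F y b) _ _) _; apply: ltr_leD => //.
by rewrite nrmB; exact: close.
Qed.

End AsymptoticCharacters.

Arguments eig_at {R d X H L h w} F x _.

Theorem theorem24 (R : realType) (d : nat) (X : manifold R d)
    (V : vector_field X) (Phi : R -> X -> X)
    (flowPhi : generates_flow V Phi)
    (H : rkhs X) (Hspd : strictly_positive_definite H)
    (Hoo S : set H) (HH : tensor_product H H)
    (core : analytic_core V Hoo)
    (rkha : rk_hilbert_algebra HH)
    (genS : generating_subspace Hoo S)
    (unit_sections : forall x : X, `|ksec H x| = 1)
    (L : ell2 R) (h : tensor_product L H)
    (tau p : R) (tau_gt0 : 0 < tau) (p_gt0 : 0 < p) (p_lt1 : p < 1)
    (F : fock_space h (weight tau p)) :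
  [/\ (forall x, star_hom_to_C (A_oo F Hoo) (Psi F x)),
      star_hom_to_fun (A_oo F Hoo) (Cboo X) (Psi_hat F),
      star_hom_to_fun (A_cstar F Hoo) (Cb X) (Psi_hat F)
    & exists emb : X -> set_type (state_space (A_cstar F Hoo)),
        [/\ (forall x (a : set_type (A_cstar F Hoo)),
               (fun m => phi F m x (set_val a) : R[i]^o) @ \oo
                 --> (set_val (emb x) a : R[i]^o)),
            (forall x (a : set_type (A_cstar F Hoo)),
               set_val (emb x) a = Psi F x (set_val a)),
            injective emb
          & continuous emb]].
Proof.
have w0 := @weight_gt0 R tau p.
have wS := weight_sum tau_gt0 p_gt0.
have wR := weight_ratio tau_gt0 p_lt1.
have oo_cstar : A_oo F Hoo `<=` A_cstar F Hoo by exact: sub_gen_smallest.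
have oo_eig a x : A_oo F Hoo a -> eig_at F x a.
  by move=> /(A_oo_smooth unit_sections w0 wS wR)[].
have cs_eig a x : A_cstar F Hoo a -> eig_at F x a.
  by move=> /(A_cstar_continuous unit_sections w0 wS wR)[].
have Pid x : Psi F x id = 1 by exact: Psi_id.
have Plc := Psi_lc unit_sections w0 wS.
have Pco := Psi_comp unit_sections w0 wS.
have Pad := Psi_adjoint unit_sections w0 wS.
have bounded_Psi a : bounded_linear a -> (forall x, eig_at F x a) ->
    exists M : R, forall x, `|Psi_hat F a x| <= M%:C.
  move=> /bounded_linearP[_ [M _ hM]] ea; exists M => x.
  by rewrite nrmE lecR; exact: Psi_bound.
have hom_fun B (cod : set (X -> R[i])) :
    (forall a x, B a -> eig_at F x a) -> (forall a, B a -> cod (Psi_hat F a)) ->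
    star_hom_to_fun B cod (Psi_hat F).
  move=> eB cB; split=> //.
  - by apply/funext => x; exact: Pid.
  - by move=> c a b Ba Bb; apply/funext => x; apply: Plc; exact: eB.
  - by move=> a b Ba Bb; apply/funext => x; apply: Pco; exact: eB.
  - by move=> a Ba; apply/funext => x; apply: Pad; exact: eB.
split.
- move=> x; split=> //.
  + by move=> c a b Ba Bb; apply: Plc; exact: oo_eig.
  + by move=> a b Ba Bb; apply: Pco; exact: oo_eig.
  + by move=> a Ba; apply: Pad; exact: oo_eig.
- apply: hom_fun => // a /(A_oo_smooth unit_sections w0 wS wR)[ba ea sa].
  by split=> //; exact: bounded_Psi.
- apply: hom_fun => // a /(A_cstar_continuous unit_sections w0 wS wR)[ba ea sa].
  by split=> //; exact: bounded_Psi.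
pose A := A_cstar F Hoo.
pose om x : {ptws set_type A -> R[i]^o} := fun a => Psi F x (set_val a).
have omS x : state_space A (om x).
  have eA (a : set_type A) : eig_at F x (set_val a).
    by apply: cs_eig; exact: set_valP.
  split.
  - by move=> c a b s; rewrite /om => ->; exact: Plc.
  (* Positivity follows from the character property: the value is the squared modulus of the value
     at [a]. *)
  - move=> a s; rewrite /om => ->; rewrite Pco//; last first.
      by have [_ _ _] := eig_at_star F x; apply; exact: eA.
    by rewrite Pad// normc_sq ler0c sqr_ge0.
  - by move=> s; rewrite /om => ->; exact: Pid.
exists (fun x => SigSub (mem_set (omS x))); split.
- move=> x a; rewrite set_valE /= /om.
  have /(eig_atP unit_sections w0 wS)[_ ha _] : eig_at F x (set_val a).
    by apply: cs_eig; exact: set_valP.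
  exact: phi_cvg.
- by move=> x a; rewrite set_valE.
- move=> x y /(congr1 val)/= exy.
  (* Evaluating both states on a_u with u = e_1 (x) f gives <f, k_x> = <f, k_y> for f in [Hoo],
     which is dense. *)
  have kxy : ksec H x = ksec H y.
    apply: (@dense_inner_ext _ _ Hoo) => [U U0 opU|f Hf].
      have [z [Uz Hz]] := core_dense core U0 opU.
      by exists z; split=> //; exact: sub_lin_span.
    rewrite innerC [RHS]innerC; congr (_^*).
    pose u := tensor h (ell2_e1 L) f.
    have Au : A (annihilation (u : h)).
      apply: oo_cstar; apply: sub_gen_smallest; right; exists u => //.
      by apply: sub_lin_span; exists (ell2_e1 L), f; split=> //; exact: finsupp_e1.
    have := congr1 (fun g => g (SigSub (mem_set Au))) exy.
    rewrite /om set_valE /= !(Psi_annihilation unit_sections F w0 wS wR).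
    rewrite !tensor_inner inner_nrm nrm_e1 expr1n.
    by rewrite !mul1r.
  apply: contrapT => /eqP nxy.
  (* With equal sections at two distinct points, the kernel form vanishes on the coefficients 1 and
     -1, against strict positive definiteness. *)
  pose pt (i : 'I_2) := if i == ord0 then x else y.
  pose c (i : 'I_2) : R[i] := if i == ord0 then 1 else -1.
  have ptI : injective pt.
    move=> i j; rewrite /pt; case: (unliftP ord0 i) => [i'|] ->;
      case: (unliftP ord0 j) => [j'|] -> //=.
    - by rewrite !ord1.
    - by move=> yx; move: nxy; rewrite yx eqxx.
    - by move=> yx; move: nxy; rewrite yx eqxx.
  have := Hspd 2%N pt c ptI (ex_intro _ ord0 (oner_neq0 _)).
  rewrite !big_ord_recl !big_ord0 /rkernel !reproducing /pt /c /= kxy.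
  rewrite rmorphN conjC1; set N := inner _ _.
  by rewrite (_ : _ + _ = 0) ?ltxx//; ring.
(* The weak-* topology is initial for the evaluations, so continuity reduces to that of each
   [Psi_hat F a]. *)
apply: continuous_comp_initial => x; apply/cvg_sup => a.
apply: (@continuous_comp_initial _ _ _ (fun g : set_type A -> R[i]^o => g a)) => z.
have [_ _ ca] := A_cstar_continuous unit_sections w0 wS wR (set_valP a).
exact: ca.
Qed.
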